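(* Let $p>5$ be a prime. Then $$\sum_{k=1}^{p-1}\frac{2^kH_k}{k}\equiv -q_p(2)^2+\frac{2}{3}p\,q_p(2)^3+\frac{p}{12}B_{p-3}\pmod{p^2},$$ $$\sum_{k=1}^{p-1}\frac{2^kH_k}{k^2}\equiv -\frac{1}{3}q_p(2)^3+\frac{23}{24}B_{p-3}\pmod{p},$$ $$\sum_{k=1}^{p-1}\frac{H_k}{k^2\cdot 2^k}\equiv \frac{5}{8}B_{p-3}\pmod{p},$$ $$\sum_{k=1}^{p-1}\frac{2^kH_k^2}{k}\equiv -\frac{1}{3}q_p(2)^3+\frac{11}{24}B_{p-3}\pmod{p},$$ $$\sum_{k=1}^{p-1}\frac{H_k^2}{k\cdot 2^k}\equiv \frac{7}{8}B_{p-3}\pmod{p},$$ and $$\sum_{k=1}^{p-1}\frac{2^kH_{k,2}}{k}\equiv -\frac{1}{3}q_p(2)^3-\frac{25}{24}B_{p-3}\pmod{p}.$$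
   Context: For positive integers $n,m$, $H_{n,m}=\sum_{k=1}^n \frac{1}{k^m}$ and $H_n=H_{n,1}=\sum_{k=1}^n\frac1k$ (with $H_0=0$). The Bernoulli numbers are defined by $B_0=1$ and $\sum_{k=0}^{n}\binom{n+1}{k}B_k=0$ for $n=1,2,3,\ldots$. For an odd prime $p$, $q_p(2)=\frac{2^{p-1}-1}{p}$ is the Fermat quotient of $2$ to base $p$. Congruences modulo $p^e$ are between rational numbers whose denominators are prime to $p$: $a\equiv b\pmod{p^e}$ means that $a-b$ is $p^e$ times a rational number with denominator prime to $p$. *)

(* Defs.v *)
From mathcomp Require Import all_boot all_order all_algebra.

Set Implicit Arguments.
Unset Strict Implicit.
Unset Printing Implicit Defensive.

Import GRing.Theory Num.Theory.
Local Open Scope ring_scope.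

(* H_{n,m}; in particular [harmonic_gen 0 m = 0]. *)
Definition harmonic_gen (n m : nat) : rat :=
  \sum_(1 <= k < n.+1) (k%:R ^+ m)^-1.

Definition harmonic (n : nat) : rat := harmonic_gen n 1.

(* [:: B_0; ...; B_n]: the defining recurrence sum_(k <= n) C(n+1,k) B_k = 0
   is solved for B_n, whose coefficient is C(n+1,n) = n+1. The lemmas
   [bernoulli0] and [bernoulli_rec] recover the defining relations. *)
Fixpoint bernoulli_seq (n : nat) : seq rat :=
  if n is n'.+1 then
    let s := bernoulli_seq n' in
    rcons s (- (\sum_(k < n) 'C(n.+1, k)%:R * s`_k) / n.+1%:R)
  else [:: 1].

Definition bernoulli (n : nat) : rat := (bernoulli_seq n)`_n.

Lemma bernoulli0 : bernoulli 0 = 1.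
Proof. by []. Qed.

Lemma size_bernoulli_seq (n : nat) : size (bernoulli_seq n) = n.+1.
Proof. by elim: n => //= n IHn; rewrite size_rcons IHn. Qed.

Lemma nth_bernoulli_seq (n k : nat) :
  (k <= n)%N -> (bernoulli_seq n)`_k = bernoulli k.
Proof.
elim: n => [|n IHn]; first by rewrite leqn0 => /eqP->.
rewrite leq_eqVlt => /predU1P[->//|lt_kn].
by rewrite /= nth_rcons size_bernoulli_seq lt_kn IHn.
Qed.

Lemma bernoulli_rec (n : nat) : (0 < n)%N ->
  \sum_(k < n.+1) 'C(n.+1, k)%:R * bernoulli k = 0.
Proof.
case: n => // n _; rewrite big_ord_recr /= binSn.
rewrite {2}/bernoulli [bernoulli_seq n.+1]/=.
rewrite nth_rcons size_bernoulli_seq ltnn eqxx mulrC divfK ?pnatr_eq0 //.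
apply/eqP; rewrite subr_eq0; apply/eqP; apply: eq_bigr => k _.
by rewrite nth_bernoulli_seq // -ltnS.
Qed.

Definition fermat_quotient2 (p : nat) : rat := (2 ^+ p.-1 - 1) / p%:R.

(* a = b modulo p^e for rational numbers: (a - b) / p^e has denominator prime
   to p. *)
Definition rat_eqmod (p e : nat) (a b : rat) : Prop :=
  exists2 r : rat, coprimez (denq r) p%:Z & a - b = p%:R ^+ e * r.

(* Main.v *)
From HB Require Import structures.
Require Import Defs.
From mathcomp Require Import all_boot all_order all_algebra.
From mathcomp Require Import ring zify.

(* Put H = H_k, G = H_{k,2}, q = q_p(2), L_s(x) = sum_(0 < k < p) x^k / k^s and
   B = B_{p-3}. Over a field of characteristic p, L_1(x) = L_1(1 - x) because
   (-1)^k C(p-1, k) = 1, and integrating this polynomial identity against dx / x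
   gives dualities x <-> 1 - x between L_2, L_3, sum x^k H_{k-1} / k^2 and sums
   with the weights H_{k-1} / k, (H_{k-1}^2 - G_{k-1}) / (2k), G_{k-1} / k. At
   x = 2 and x = -1 they express the weight 3 sums of the theorem by L_3(2) and
   alternating sums; the reflection k -> p - k reduces the latter to L_3(-1).
   The constants sum H_k / k^2 = B and L_3(-1) = - B / 2 are read off the linear
   coefficient of the Faulhaber polynomial of exponent p - 3 and of its
   duplication formula. Finally L_1(2) L_2(2) is expanded by splitting i + j
   modulo p, which yields L_3(2) = - q^3 / 3 - 7 B / 24 from L_1(2) = - 2 q and
   L_2(2) = - q^2.
   For the congruence modulo p^2, the same expansion of L_1(2)^2 is carried out
   modulo p^2: it is an equation for sum 2^k H_k / k whose other terms need
   only (-1)^k C(p-1, k) = 1 - p H_k modulo p^2 and the weight 3 sums. *)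

Set Implicit Arguments.
Unset Strict Implicit.
Unset Printing Implicit Defensive.

Import GRing.Theory Num.Theory.
Local Open Scope ring_scope.

(** * Finite sums and the binomial transform *)

Section FiniteSums.
Variable V : zmodType.

Lemma sum_nat_rev (p : nat) (f : nat -> V) :
  \sum_(1 <= k < p) f k = \sum_(1 <= k < p) f (p - k)%N.
Proof. by rewrite big_nat_rev; apply: eq_big_nat => k _; rewrite add1n subSS. Qed.

Lemma sum_nat_telescope (p : nat) (u : nat -> V) : (0 < p)%N ->
  \sum_(1 <= k < p) (u k - u k.-1) = u p.-1 - u 0%N.
Proof.
by case: p => // p _; rewrite big_add1 /= -(telescope_sumr u (leq0n p)).
Qed.

Lemma sum_nat_triangle (p : nat) (g : nat -> nat -> V) :
  \sum_(1 <= m < p) \sum_(1 <= j < m) g m j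
    = \sum_(1 <= j < p) \sum_(j.+1 <= m < p) g m j.
Proof.
elim: p => [|p IHp]; first by rewrite !big_geq.
case: p IHp => [|p] IHp; first by rewrite !big_geq.
rewrite big_nat_recr //= IHp [RHS]big_nat_recr //= [X in _ = _ + X]big_geq // addr0.
rewrite -big_split /=; apply: eq_big_nat => j /andP[_ jp].
by rewrite [RHS]big_nat_recr.
Qed.

(* Reduction of i + j modulo p. *)
Lemma sum_nat_pairs (p : nat) (f : nat -> nat -> V) :
  \sum_(1 <= i < p) \sum_(1 <= j < p) f i j
    = \sum_(1 <= m < p) \sum_(1 <= j < m) f (m - j)%N j
      + \sum_(1 <= j < p) f (p - j)%N j
      + \sum_(1 <= m < p) \sum_(m.+1 <= j < p) f (p + m - j)%N j.
Proof.
rewrite sum_nat_triangle -(sum_nat_triangle p (fun j m => f (p + m - j)%N j)).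
rewrite exchange_big /= -!big_split /=; apply: eq_big_nat => j /andP[j0 jp].
rewrite (big_cat_nat _ (n := p - j)) ?subn_gt0 //=; last by rewrite leq_subr.
rewrite [X in _ + X]big_ltn ?ltn_subrL ?j0 ?(leq_trans _ jp) // addrA.
congr (_ + _ + _).
- rewrite -{1}(add1n j) -{2}(subnK (ltnW jp)) big_addn addnK.
  by apply: eq_bigr => i _; rewrite addnK.
rewrite -(add1n (p - j)) big_addn subKn ?(ltnW jp) //.
apply: eq_big_nat => i _.
by congr f; lia.
Qed.

End FiniteSums.

Lemma signr_subn_odd (R : pzRingType) (n k : nat) : odd n -> (k <= n)%N ->
  (-1) ^+ (n - k) = - (-1) ^+ k :> R.
Proof.
move=> n_odd kn; rewrite -signr_odd oddB // n_odd.
by rewrite -[(-1) ^+ k]signr_odd; case: (odd k); rewrite ?expr0 ?expr1 ?opprK.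
Qed.

(** Over [rat] this is convertible to [harmonic_gen k s]; in characteristic [p] it is used for
    [k < p], where no denominator vanishes. *)
Definition harm (R : fieldType) (s k : nat) : R :=
  \sum_(1 <= i < k.+1) (i%:R ^+ s : R)^-1.

Section Harmonic.
Variable R : fieldType.

Lemma harm0 s : harm R s 0 = 0.
Proof. by rewrite /harm big_geq. Qed.

Lemma harmS s k : harm R s k.+1 = harm R s k + (k.+1%:R ^+ s)^-1.
Proof. by rewrite /harm big_nat_recr. Qed.

Lemma harm_pred s k : (0 < k)%N -> harm R s k.-1 = harm R s k - (k%:R ^+ s)^-1.
Proof. by case: k => // k _; rewrite harmS addrK. Qed.

End Harmonic.

Section BinomialTransform.
Variable F : fieldType.

(* [C(n, k) - C(n - 1, k) = C(n - 1, k - 1)] and [C(n - 1, k - 1) / k = C(n, k) / n]. *)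
Lemma binomial_transform_div (g : nat -> F) (n : nat) :
  (forall k, (0 < k <= n)%N -> k%:R != 0 :> F) ->
  \sum_(1 <= k < n.+1) 'C(n, k)%:R * g k / k%:R
    = \sum_(1 <= m < n.+1) m%:R^-1 * \sum_(1 <= k < m.+1) 'C(m, k)%:R * g k.
Proof.
elim: n => [|n IHn] nz; first by rewrite !big_geq.
rewrite [RHS]big_nat_recr //= -IHn; last first.
  by move=> k /andP[k0 kn]; apply: nz; rewrite k0 ltnW.
have -> : \sum_(1 <= k < n.+1) 'C(n, k)%:R * g k / k%:R
   = \sum_(1 <= k < n.+2) 'C(n, k)%:R * g k / k%:R.
  by rewrite [RHS]big_nat_recr //= bin_small // !mul0r addr0.
rewrite mulr_sumr -big_split /=; apply: eq_big_nat => -[//|k] /andP[_ kn].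
have nk : k.+1%:R != 0 :> F by apply: nz; lia.
have nn : n.+1%:R != 0 :> F by apply: nz; lia.
have E : n.+1%:R * 'C(n, k)%:R = k.+1%:R * 'C(n.+1, k.+1)%:R :> F.
  by rewrite -!natrM mul_bin_diag.
rewrite [X in X * g _ / _](_ : _ = 'C(n, k.+1)%:R + 'C(n, k)%:R); last first.
  by rewrite -natrD binS.
have -> : 'C(n, k)%:R = n.+1%:R^-1 * (k.+1%:R * 'C(n.+1, k.+1)%:R) :> F.
  by rewrite -E mulKf.
move: (k.+1%:R) nk (n.+1%:R) nn => a a0 b b0; field; apply/andP; split=> //.
Qed.

Lemma sum_binomial_pow (x : F) (n : nat) :
  \sum_(1 <= k < n.+1) 'C(n, k)%:R * (- x) ^+ k = (1 - x) ^+ n - 1.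
Proof.
rewrite exprDn -(big_mkord xpredT (fun i => 1 ^+ (n - i) * (- x) ^+ i *+ 'C(n, i))).
rewrite big_ltn // expr0 expr1n mulr1 bin0 mulr1n addrAC subrr add0r.
by apply: eq_bigr => i _; rewrite expr1n mul1r mulr_natl.
Qed.

End BinomialTransform.

(** * Bernoulli polynomials *)

Section BernoulliPolynomial.
Variables (R : comNzRingType) (b : nat -> R).

(** The Bernoulli polynomial of an arbitrary sequence [b], so that residues of Bernoulli numbers
    modulo a prime can be inserted; their recurrence is available only below a bound. *)
Definition bern_poly (m : nat) : {poly R} :=
  \sum_(i < m.+1) ('C(m, i)%:R * b i) *: 'X^(m - i).

Lemma horner_bern_poly (m : nat) (x : R) :
  (bern_poly m).[x] = \sum_(i < m.+1) 'C(m, i)%:R * b i * x ^+ (m - i).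
Proof. by rewrite horner_sum; apply: eq_bigr => i _; rewrite hornerZ hornerXn. Qed.

Lemma horner0_bern_poly (m : nat) : (bern_poly m).[0] = b m.
Proof.
rewrite horner_bern_poly big_ord_recr /= subnn binn mul1r mulr1 big1 ?add0r // => i _.
by rewrite expr0n subn_eq0 leqNgt ltn_ord mulr0.
Qed.

Lemma size_bern_poly (m : nat) : (size (bern_poly m) <= m.+1)%N.
Proof.
apply: (leq_trans (size_sum _ _ _)); apply/bigmax_leqP => i _.
by rewrite (leq_trans (size_scale_leq _ _)) // size_polyXn ltnS leq_subr.
Qed.

Lemma deriv_bern_poly (m : nat) : (bern_poly m.+1)^`() = bern_poly m *+ m.+1.
Proof.
rewrite /bern_poly big_ord_recr /= subnn expr0 derivD derivZ.
rewrite -polyC1 derivC scaler0 addr0 raddf_sum /= -sumrMnl.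
apply: eq_bigr => i _; rewrite derivZ derivXn -!scaler_nat !scalerA.
rewrite subSn ?leq_ord //=; congr (_ *: _).
rewrite -mulrA [b i * _]mulrC !mulrA; congr (_ * b i).
rewrite -!natrM; congr (_%:R); have := mul_bin_down m.+1 i; rewrite subSn ?leq_ord //=; lia.
Qed.

(** After expanding [(x + 1) ^+ (m - i)] and exchanging the sums, the coefficient of [x ^+ l] is
    [C(m, l)] times the sum of [C(m - l, i) * b i]; by the recurrence this is [b (m - l)], plus 1
    when [m - l = 1]. *)
Lemma bern_poly_shift (m : nat) (x : R) : b 0%N = 1 ->
  (forall n, (0 < n < m)%N -> \sum_(k < n.+1) 'C(n.+1, k)%:R * b k = 0) ->
  (bern_poly m).[x + 1] = (bern_poly m).[x] + x ^+ m.-1 *+ m.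
Proof.
move=> b0 brec.
have S n : (n <= m)%N ->
    \sum_(i < m.+1) 'C(n, i)%:R * b i = b n + (n == 1%N)%:R.
  move=> nm; rewrite -(big_mkord xpredT (fun i => 'C(n, i)%:R * b i)).
  rewrite (big_cat_nat _ (n := n.+1)) //= [X in _ + X]big1_seq ?addr0; last first.
    by move=> i; rewrite mem_index_iota => /andP[_ /andP[ni _]]; rewrite bin_small ?mul0r.
  rewrite big_nat_recr //= binn mul1r addrC; congr (_ + _).
  case: n nm => [|[|n]] nm; first by rewrite big_geq.
    by rewrite big_nat1 bin0 mul1r b0.
  by rewrite big_mkord brec.
have X i : (i <= m)%N ->
    (x + 1) ^+ (m - i) = \sum_(l < m.+1) 'C(m - i, l)%:R * x ^+ l.
  move=> im; rewrite -(big_mkord xpredT (fun l => 'C(m - i, l)%:R * x ^+ l)).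
  rewrite (big_cat_nat _ (n := (m - i).+1)) //= ?ltnS ?leq_subr //.
  rewrite [X in _ = _ + X]big1_seq ?addr0; last first.
    by move=> l; rewrite mem_index_iota => /andP[_ /andP[ni _]]; rewrite bin_small ?mul0r.
  rewrite addrC exprDn big_mkord; apply: eq_bigr => l _.
  by rewrite expr1n mul1r mulr_natl.
have C (i l : nat) : (i <= m)%N -> (l <= m)%N ->
    ('C(m, i) * 'C(m - i, l) = 'C(m, l) * 'C(m - l, i))%N.
  move=> im lm; have [iml|iml] := leqP (i + l) m; last first.
    rewrite ['C(m - i, l)]bin_small ?['C(m - l, i)]bin_small ?muln0 //; lia.
  have lmi : (l <= m - i)%N by lia.
  have iml' : (i <= m - l)%N by lia.
  (* Multiplied by the factorials of [i], [l] and [m - i - l], both products become the factorial of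
     [m]. *)
  apply/eqP; rewrite -(eqn_pmul2r (fact_gt0 i)) -(eqn_pmul2r (fact_gt0 l)).
  rewrite -(eqn_pmul2r (fact_gt0 (m - i - l))).
  move: (bin_fact im) (bin_fact lm) (bin_fact lmi) (bin_fact iml').
  rewrite [(m - l - i)%N]subnAC => E1 E2 E3 E4.
  rewrite -E3 in E1; rewrite -E4 in E2.
  by apply/eqP; transitivity (m`!)%N; [rewrite -E1|rewrite -E2]; ring.
rewrite !horner_bern_poly.
under eq_bigr => i _ do rewrite X ?leq_ord // mulr_sumr.
rewrite exchange_big /=.
transitivity (\sum_(l < m.+1) (x ^+ l * 'C(m, l)%:R * b (m - l)%N
                                + x ^+ l * 'C(m, l)%:R * (m - l == 1)%N%:R)).
  apply: eq_bigr => l _; rewrite -mulrDr -S ?leq_subr // mulr_sumr; apply: eq_bigr => i _.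
  have : 'C(m, i)%:R * 'C(m - i, l)%:R = 'C(m, l)%:R * 'C(m - l, i)%:R :> R.
    by rewrite -!natrM C ?leq_ord.
  move: ('C(m, i)%:R) ('C(m - i, l)%:R) ('C(m, l)%:R) ('C(m - l, i)%:R : R) => u v w z E.
  have -> : x ^+ l * w * (z * b i) = (w * z) * (x ^+ l * b i) by ring.
  by rewrite -E; ring.
rewrite big_split /=; congr (_ + _).
  rewrite (reindex_inj rev_ord_inj) /=; apply: eq_bigr => i _.
  rewrite subSS subKn ?leq_ord // bin_sub ?leq_ord //; ring.
case: m {S X C brec} => [|m]; first by rewrite big_ord1 /= mulr0.
rewrite big_ord_recr /= subnn mulr0 addr0 big_ord_recr /= subSn // subnn mulr1.
rewrite big1 ?add0r; first by rewrite binSn mulr_natr.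
move=> i _; rewrite (_ : (m.+1 - i == 1)%N = false) ?mulr0 //.
by have := ltn_ord i; lia.
Qed.

End BernoulliPolynomial.

(** * Harmonic sums in characteristic p *)

Section CharP.
Variables (F : fieldType) (p : nat).
Hypothesis charFp : p \in [pchar F].

Let p_prime : prime p := pcharf_prime charFp.

Lemma charp_odd : (2 < p)%N -> odd p.
Proof. by case: (even_prime p_prime) => // ->. Qed.

Lemma natf_neq0_lt (k : nat) : (0 < k < p)%N -> k%:R != 0 :> F.
Proof.
case/andP=> k0 kp; rewrite -(dvdn_pcharf charFp).
by apply/negP => /(dvdn_leq k0); rewrite leqNgt kp.
Qed.

Lemma natf_subp (k : nat) : (k <= p)%N -> (p - k)%:R = - k%:R :> F.
Proof. by move=> kp; rewrite natrB // (pcharf0 charFp) sub0r. Qed.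

Lemma natf_subp_expV (s k : nat) : (k <= p)%N ->
  ((p - k)%:R ^+ s)^-1 = (-1) ^+ s * (k%:R ^+ s)^-1 :> F.
Proof.
move=> kp; rewrite natf_subp //; move: (k%:R : F) => x.
by rewrite (exprNn x s : (- x) ^+ s = (-1) ^+ s * x ^+ s) invfM invr_sign.
Qed.

Lemma natf_expp (k : nat) : k%:R ^+ p = k%:R :> F.
Proof. exact: (pFrobenius_aut_nat charFp). Qed.

Lemma natf_exp_pred (k : nat) : (0 < k < p)%N -> k%:R ^+ p.-1 = 1 :> F.
Proof.
move=> kp; apply: (mulfI (natf_neq0_lt kp)).
by rewrite -exprS prednK ?prime_gt0 // natf_expp mulr1.
Qed.

Lemma natf_expB (k s : nat) : (0 < k < p)%N -> (s < p)%N ->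
  k%:R ^+ (p.-1 - s) = (k%:R ^+ s)^-1 :> F.
Proof.
move=> kp sp; have nz := natf_neq0_lt kp.
apply: (mulIf (expf_neq0 s nz)); rewrite mulVf ?expf_neq0 //.
by rewrite -exprD subnK ?natf_exp_pred //; lia.
Qed.

(** The powers of exponent [e + 1] telescope to [p ^ (e + 1) = 0]. Expanding the increments, the
    induction hypothesis leaves only [e + 1] times the wanted sum, and [e + 1 < p] is invertible. *)
Lemma sum_natX_charp (e : nat) : (e < p.-1)%N -> \sum_(0 <= k < p) k%:R ^+ e = 0 :> F.
Proof.
elim/ltn_ind: e => e IHe ep.
have := telescope_sumr (fun k => k%:R ^+ e.+1 : F) (leq0n p).
rewrite (pcharf0 charFp) subrr.
have -> : \sum_(0 <= k < p) (k.+1%:R ^+ e.+1 - k%:R ^+ e.+1)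
   = \sum_(i < e.+1) 'C(e.+1, i)%:R * \sum_(0 <= k < p) k%:R ^+ i :> F.
  under [RHS]eq_bigr => i _ do rewrite mulr_sumr.
  rewrite exchange_big /=; apply: eq_bigr => k _.
  rewrite -natr1 [k%:R + 1]addrC exprDn big_ord_recr /= subnn expr0 mul1r binn mulr1n addrK.
  by apply: eq_bigr => i _; rewrite expr1n mul1r mulr_natl.
rewrite big_ord_recr /= big1 ?add0r => [/eqP|i _].
  rewrite mulf_eq0 binSn (negPf (natf_neq0_lt _)) /=; first by move/eqP. by lia.
by rewrite IHe ?mulr0 //; have := ltn_ord i; lia.
Qed.

(** By Fermat's little theorem this is a power sum of exponent [p - 1 - s], which lies between 1 and
    [p - 2]. *)
Lemma harm_charp0 (s : nat) : (0 < s < p.-1)%N -> harm F s p.-1 = 0.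
Proof.
move=> sp; rewrite -(sum_natX_charp (e := p.-1 - s)); last by lia.
rewrite /harm prednK ?prime_gt0 // [RHS]big_ltn ?prime_gt0 //.
rewrite expr0n (_ : _ == 0%N = false) ?add0r; last by apply/eqP; lia.
by apply: eq_big_nat => k kp; rewrite natf_expB //; lia.
Qed.

(** Since the full sum up to [p - 1] vanishes, the sum up to [p - k] is minus its tail, and
    [i -> p - i] carries the tail to [(-1) ^+ s] times the sum up to [k - 1]. *)
Lemma harm_reflect (s k : nat) : (0 < s < p.-1)%N -> (0 < k < p)%N ->
  harm F s (p - k) = (-1) ^+ s.+1 * harm F s k.-1.
Proof.
move=> sp; case: k => // k /andP[_ kp] /=.
elim: k kp => [|k IHk] kp; first by rewrite subn1 harm_charp0 // harm0 mulr0.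
have := IHk (ltnW kp); rewrite (_ : p - k.+1 = (p - k.+2).+1)%N; last by lia.
rewrite !harmS (_ : (p - k.+2).+1 = p - k.+1)%N; last by lia.
rewrite natf_subp_expV; last by lia.
move/(canRL (addrK _)) => ->.
by rewrite mulrDr exprS; ring.
Qed.

Lemma harm_reflect_pred (s k : nat) : (0 < s < p.-1)%N -> (0 < k < p)%N ->
  harm F s (p - k).-1 = (-1) ^+ s.+1 * harm F s k.
Proof.
move=> sp kp; rewrite harm_pred; last by lia.
rewrite harm_reflect // natf_subp_expV; last by lia.
rewrite harm_pred; last by lia.
by rewrite exprS; ring.
Qed.

(** The residues below [p] are [p] distinct roots of [f - g], which has degree less than [p]. *)
Lemma poly_eq_nat_charp (f g : {poly F}) : (size f <= p)%N -> (size g <= p)%N ->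
  (forall k, (k < p)%N -> f.[k%:R] = g.[k%:R]) -> f = g.
Proof.
move=> sf sg fg; apply/eqP; rewrite -subr_eq0; apply/negPn/negP => nz.
have := max_poly_roots nz (rs := [seq k%:R | k <- iota 0 p]).
rewrite size_map size_iota => H.
have : (p < size (f - g)%R)%N.
  apply: H.
    apply/allP => _ /mapP[k + ->]; rewrite mem_iota /root => /andP[_ kp].
    by rewrite hornerD hornerN fg ?subrr.
  rewrite map_inj_in_uniq ?iota_uniq // => i j; rewrite !mem_iota !add0n /=.
  wlog ij : i j / (i <= j)%N => [W ip jp E|ip jp E].
    by case/orP: (leq_total i j) => ij; [|symmetry]; apply: W.
  apply/eqP; rewrite eqn_leq ij /= leqNgt; apply/negP => lij.
  have /negP[] : (j - i)%:R != 0 :> F by apply: natf_neq0_lt; lia.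
  by rewrite natrB // E subrr.
rewrite ltnNge (leq_trans (size_add _ _)) // size_opp geq_max sf sg //.
Qed.

End CharP.

(** * Bernoulli numbers and power sums in characteristic p *)

Lemma sum_even_terms (F : fieldType) (f : nat -> F) (n : nat) :
  \sum_(1 <= k < n.*2.+1) (f k + (-1) ^+ k * f k) = \sum_(1 <= k < n.+1) f k.*2 *+ 2.
Proof.
elim: n => [|n IHn]; first by rewrite !big_geq.
rewrite doubleS big_nat_recr //= big_nat_recr //= IHn [RHS]big_nat_recr //=.
rewrite -addrA; congr (_ + _).
rewrite !exprS -[_ ^+ n.*2]signr_odd odd_double doubleS mulr2n; ring.
Qed.

Section BernoulliCharP.
Variables (F : fieldType) (p : nat).
Hypotheses (charFp : p \in [pchar F]) (p_gt5 : (5 < p)%N).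
Variable b : nat -> F.
Hypothesis b0 : b 0%N = 1.
Hypothesis brec : forall n, (0 < n < p.-1)%N ->
  \sum_(k < n.+1) 'C(n.+1, k)%:R * b k = 0.

Local Notation H := (harm F 1).
Local Notation G := (harm F 2).

Let p_odd : odd p := charp_odd charFp (ltn_trans (isT : 2 < 5)%N p_gt5).

Let nz2 : 2%:R != 0 :> F. Proof. by apply: (natf_neq0_lt charFp); lia. Qed.
Let nz4 : 4%:R != 0 :> F. Proof. by apply: (natf_neq0_lt charFp); lia. Qed.
Let nz3 : 3%:R != 0 :> F. Proof. by apply: (natf_neq0_lt charFp); lia. Qed.

(* The polynomial with values [harm F 2 (k - 1)] at [k]; its linear coefficient
   is [b (p - 3)]. *)
Let P : {poly F} := (- 2%:R)^-1 *: (bern_poly b (p - 2) - (b (p - 2)%N)%:P).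

Let P0 : P.[0] = 0.
Proof. by rewrite /P hornerZ hornerD hornerN hornerC horner0_bern_poly subrr mulr0. Qed.

Let sizeP : (size P <= p.-1)%N.
Proof.
rewrite (leq_trans (size_scale_leq _ _)) // (leq_trans (size_add _ _)) // geq_max.
have s := size_bern_poly b (p - 2).
rewrite (leq_trans s) /=; last by lia.
by rewrite size_opp (leq_trans (size_polyC_leq1 _)) //; lia.
Qed.

Let derivP : P^`() = bern_poly b (p - 3).
Proof.
rewrite /P derivZ derivB derivC subr0 (_ : p - 2 = (p - 3).+1)%N; last by lia.
rewrite deriv_bern_poly -scaler_nat scalerA (_ : (p - 3).+1 = p - 2)%N; last by lia.
rewrite (natf_subp charFp) ?mulVf ?scale1r ?oppr_eq0 //; lia.
Qed.

(** The factor [p - 2] of the difference equation is [-2] in [F] and cancels the normalization of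
    [P]. *)
Let P_shift x : P.[x + 1] = P.[x] + x ^+ (p - 3).
Proof.
rewrite /P !hornerZ !hornerD !hornerN !hornerC bern_poly_shift //; last first.
  by move=> n np; apply: brec; lia.
rewrite (_ : (p - 2).-1 = p - 3)%N; last by lia.
rewrite -[_ ^+ _ *+ _]mulr_natr (natf_subp charFp); last by lia.
move: (x ^+ _) (bern_poly _ _) => y f; field; by rewrite ?oppr_eq0.
Qed.

Let P_nat k : (k < p)%N -> P.[k.+1%:R] = G k.
Proof.
elim: k => [|k IHk] kp.
  rewrite -[1%:R]add0r P_shift P0 harm0 expr0n (_ : (_ == 0)%N = false) ?addr0 //.
  by apply/eqP; lia.
rewrite -natr1 P_shift IHk ?(ltnW kp) // harmS; congr (_ + _).
rewrite (_ : p - 3 = p.-1 - 2)%N; last by lia.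
by rewrite (natf_expB charFp) //; lia.
Qed.

(** Replace [G k.-1] by [P.[k%:R]] and divide by [k] term by term. The constant coefficient is 0,
    the exponents from 1 on give vanishing power sums, and the linear coefficient is multiplied by
    [p - 1 = -1]. *)
Lemma sum_harm2_div : \sum_(1 <= k < p) G k.-1 / k%:R = - b (p - 3)%N.
Proof.
have -> : b (p - 3)%N = P`_1.
  by rewrite -(horner0_bern_poly b) -derivP horner_coef0 coef_deriv mulr1n.
transitivity (\sum_(i < p.-1) P`_i * \sum_(1 <= k < p) (k%:R ^+ i / k%:R)).
  under [RHS]eq_bigr => i _ do rewrite mulr_sumr.
  rewrite exchange_big /=; apply: eq_big_nat => -[//|k] /andP[_ kp].
  rewrite -P_nat 1?ltnW // (horner_coef_wide _ sizeP) mulr_suml.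
  by apply: eq_bigr => i _; rewrite mulrA.
have i1 : (1 < p.-1)%N by lia.
rewrite (bigD1 (Ordinal i1)) //= [X in _ + X]big1 ?addr0.
  rewrite -[RHS]mulrN1; congr (_ * _).
  under eq_big_nat => k kp do rewrite expr1 divff ?(natf_neq0_lt charFp) //.
  by rewrite big_const_nat iter_addr_0 (natf_subp charFp) //; lia.
move=> [[|[|i]] /= ip] //= => _; first by rewrite -horner_coef0 P0 mul0r.
rewrite (eq_big_nat _ _ (F2 := fun k => k%:R ^+ i.+1)); last first.
  by move=> k kp; rewrite exprSr mulfK ?(natf_neq0_lt charFp).
have := sum_natX_charp charFp (e := i.+1) => /(_ (ltnW ip)).
rewrite [\sum_(0 <= k < p) _]big_ltn; last by lia.
by rewrite mulr0n expr0n add0r => ->; rewrite mulr0.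
Qed.

(** Summation by parts: [H k * G k] increases by [H k / k ^ 2 + G k.-1 / k], and it vanishes at both
    ends. *)
Lemma sum_harm1_div2 : \sum_(1 <= k < p) H k / k%:R ^+ 2 = b (p - 3)%N.
Proof.
have E : \sum_(1 <= k < p) (H k * G k - H k.-1 * G k.-1) = 0.
  rewrite (sum_nat_telescope (fun k => H k * G k)); last by lia.
  by rewrite !(harm_charp0 charFp) ?harm0; [ring|lia..].
transitivity (\sum_(1 <= k < p) (- (G k.-1 / k%:R) + (H k * G k - H k.-1 * G k.-1))).
  apply: eq_big_nat => k /andP[k0 kp]; rewrite !harm_pred // expr1.
  have nz : k%:R != 0 :> F by rewrite (natf_neq0_lt charFp) // k0.
  by field.
by rewrite big_split /= sumrN E sum_harm2_div opprK addr0.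
Qed.

(* Comparing the linear terms of [P(2x) = (P(x) + P(x + 1/2) - P(1/2)) / 4],
   which is the even-odd splitting of the sum of [j ^ (p - 3)] over [j < 2x]. *)
Let P_double : 4%:R *: (P \Po (2%:R *: 'X))
  = P + (P \Po ('X + (2%:R^-1)%:P)) - (P.[2%:R^-1])%:P.
Proof.
have E2 : 4%:R * 2%:R ^+ (p - 3) = 1 :> F.
  rewrite (_ : 4%:R = 2%:R ^+ 2); last by ring.
  by rewrite -exprD (_ : 2 + (p - 3) = p.-1)%N ?(natf_exp_pred charFp) //; lia.
move: (P) sizeP P0 P_shift => Q sizeQ Q0 Q_shift.
have sz (S : {poly F}) : (size S <= 2)%N -> (size (Q \Po S) <= p)%N.
  move=> sS; apply: (leq_trans (size_comp_poly_leq _ _)).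
  move: sizeQ sS; case: (size Q) => [|s]; case: (size S) => [|[|[|t]]] //=; lia.
apply: (poly_eq_nat_charp charFp).
- apply: (leq_trans (size_scale_leq _ _)); apply: sz.
  by apply: (leq_trans (size_scale_leq _ _)); rewrite size_polyX.
- rewrite (leq_trans (size_add _ _)) // geq_max; apply/andP; split.
    rewrite (leq_trans (size_add _ _)) // geq_max; apply/andP; split.
      by rewrite (leq_trans sizeQ) // leq_pred.
    by rewrite sz // size_XaddC.
  by rewrite size_opp (leq_trans (size_polyC_leq1 _)) //; lia.
(* Passing from [x] to [x + 1] adds [x ^ (p - 3) + (x + 1/2) ^ (p - 3)] to both sides: on the left
   [P] is shifted twice, and [E2] absorbs the factor 4. *)
elim=> [|k IHk] kp.
  by rewrite !(hornerE, horner_comp) /= Q0; ring.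
move: (IHk (ltnW kp)); rewrite !(hornerE, horner_comp) /=.
rewrite -[k.+1%:R]natr1; move: (k%:R : F) => x IH.
have -> : 2%:R * (x + 1) = 2%:R * x + 1 + 1 by ring.
have -> : x + 1 + 2%:R^-1 = x + 2%:R^-1 + 1 by ring.
rewrite !Q_shift mulrDr mulrDr IH.
have -> : 2%:R * x + 1 = 2%:R * (x + 2%:R^-1) by field.
rewrite !exprMn !mulrA E2; ring.
Qed.

Let P_deriv_nat k : (k < p)%N ->
  (bern_poly b (p - 3)).[k.+1%:R] = b (p - 3)%N - 3%:R * harm F 3 k.
Proof.
have shift x : (bern_poly b (p - 3)).[x + 1]
      = (bern_poly b (p - 3)).[x] - 3%:R * x ^+ (p - 4).
  rewrite bern_poly_shift //; last by move=> n np; apply: brec; lia.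
  rewrite -mulr_natl (natf_subp charFp); last by lia.
  by rewrite (_ : (p - 3).-1 = p - 4)%N ?mulNr //; lia.
elim: k => [|k IHk] kp.
  rewrite -[1%:R]add0r shift horner0_bern_poly harm0 expr0n.
  by rewrite (_ : (_ == 0)%N = false) //; apply/eqP; lia.
rewrite -natr1 shift IHk ?(ltnW kp) // harmS mulrDr opprD addrA; congr (_ - _ * _).
rewrite (_ : p - 4 = p.-1 - 3)%N; last by lia.
by rewrite (natf_expB charFp) //; lia.
Qed.

(** Differentiating [P_double] at 0 gives [8 P'(0) = P'(0) + P'(1/2)]. Here [P'(0)] is [b (p - 3)],
    and [1/2] is the residue of [(p + 1) / 2], where [P_deriv_nat] applies. *)
Lemma harm3_half : harm F 3 p./2 = - 2%:R * b (p - 3)%N.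
Proof.
have pE : p = (p./2).*2.+1 by rewrite -[LHS]odd_double_half p_odd.
have E : (2%:R^-1 : F) = (p./2).+1%:R.
  apply: (mulfI nz2); rewrite mulfV // -natrM mul2n doubleS -pE.
  by rewrite -natr1 (pcharf0 charFp) add0r.
move: (P) derivP P_double => Q derivQ /(congr1 (fun f => (f^`()).[0])).
rewrite !(derivE, deriv_comp) derivQ !(hornerE, horner_comp) horner0_bern_poly.
rewrite E P_deriv_nat /=; last by rewrite {2}pE; lia.
move: (b _) (harm _ _ _) => B h D; apply: (mulfI nz3).
transitivity (B + B - (B + (B - 3%:R * h) - 0)); first by ring.
by rewrite -D; ring.
Qed.

(** The sum of all [1 / k ^ 3] vanishes, so the alternating sum is twice the sum over even [k], that
    is [harm F 3 p./2] divided by 4. *)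
Lemma sum_alt_div3 :
  \sum_(1 <= k < p) (-1) ^+ k / k%:R ^+ 3 = - b (p - 3)%N / 2%:R.
Proof.
have pE : p = (p./2).*2.+1 by rewrite -[LHS]odd_double_half p_odd.
have := sum_even_terms (fun k => (k%:R ^+ 3)^-1 : F) p./2.
have h0 : \sum_(1 <= k < p) (k%:R ^+ 3)^-1 = 0 :> F.
  by rewrite -[RHS](harm_charp0 charFp (s := 3)) /harm ?prednK //; lia.
rewrite -pE big_split /= h0 add0r => ->.
transitivity (4%:R^-1 * harm F 3 p./2).
  rewrite /harm mulr_sumr; apply: eq_big_nat => k /andP[k0 kp].
  have nz : k%:R != 0 :> F by rewrite (natf_neq0_lt charFp) //; lia.
  rewrite -mul2n natrM; move: (k%:R : F) nz => x nz.
  by field; rewrite nz nz4 nz2.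
by rewrite harm3_half; field; rewrite nz4 nz2.
Qed.

End BernoulliCharP.

(** * Duality of finite polylogarithms *)

Section Duality.
Variables (F : fieldType) (p : nat).
Hypothesis charFp : p \in [pchar F].

Local Notation H := (harm F 1).
Local Notation G := (harm F 2).

Let p_gt1 : (1 < p)%N := prime_gt1 (pcharf_prime charFp).

Lemma bin_pred_charp (k : nat) : (k < p)%N -> 'C(p.-1, k)%:R = (-1) ^+ k :> F.
Proof.
elim: k => [|k IHk] kp; first by rewrite bin0.
have : 'C(p, k.+1)%:R = 0 :> F.
  by apply/eqP; rewrite -(dvdn_pcharf charFp) prime_dvd_bin ?(pcharf_prime charFp).
rewrite -[p in 'C(p, _)]prednK; last by lia.
rewrite binS natrD IHk ?(ltnW kp) // => /eqP.
by rewrite addr_eq0 exprS mulN1r => /eqP.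
Qed.

(** The signs that turn [x ^+ k] into [(- x) ^+ k] are the binomials [C(p - 1, k)]. The binomial
    transform then yields [((1 - x) ^+ m - 1) / m], and the sum of [1 / m] vanishes. *)
Lemma polylog1_dual (x : F) : (2 < p)%N ->
  \sum_(1 <= k < p) x ^+ k / k%:R = \sum_(1 <= k < p) (1 - x) ^+ k / k%:R.
Proof.
move=> p_gt2; have p0 : (0 < p)%N by lia.
have := binomial_transform_div (F := F) (fun k => (- x) ^+ k) (n := p.-1).
rewrite prednK // => E.
transitivity (\sum_(1 <= k < p) 'C(p.-1, k)%:R * (- x) ^+ k / k%:R).
  apply: eq_big_nat => k /andP[_ kp].
  by rewrite bin_pred_charp // -exprMn mulrNN mul1r.
rewrite E; last by move=> k kp; apply: (natf_neq0_lt charFp); lia.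
under eq_bigr => k _ do rewrite sum_binomial_pow mulrBr mulr1 mulrC.
rewrite big_split /= sumrN.
have := harm_charp0 charFp (s := 1); rewrite /harm prednK // => ->; last by lia.
by rewrite subr0.
Qed.

(* Term-by-term integration against [dx / x]: both sides have the same derivative
   and degree less than [p]. *)
Lemma polylog_dual_step (a u : nat -> F) : u 0%N = 0 -> u p.-1 = 0 ->
  (forall x : F, \sum_(1 <= k < p) a k * x ^+ k
     = - \sum_(1 <= k < p) (u k - u k.-1) * (1 - x) ^+ k) ->
  forall x : F, \sum_(1 <= k < p) a k / k%:R * x ^+ k
     = \sum_(1 <= k < p) u k.-1 / k%:R * (1 - x) ^+ k + \sum_(1 <= k < p) a k / k%:R.
Proof.
move=> u0 up au x.
pose f : {poly F} := \sum_(1 <= k < p) (a k / k%:R) *: 'X^k.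
pose g : {poly F} := \sum_(1 <= k < p) (u k.-1 / k%:R) *: (1 - 'X) ^+ k.
have fE y : f.[y] = \sum_(1 <= k < p) a k / k%:R * y ^+ k.
  by rewrite horner_sum; apply: eq_bigr => k _; rewrite !hornerE.
have gE y : g.[y] = \sum_(1 <= k < p) u k.-1 / k%:R * (1 - y) ^+ k.
  by rewrite horner_sum; apply: eq_bigr => k _; rewrite !hornerE.
have size1X : (size (1 - 'X : {poly F})%R <= 2)%N.
  by rewrite (leq_trans (size_add _ _)) // size_opp size_polyX size_poly1.
have szX (c : nat -> F) : (size (\sum_(1 <= k < p) c k *: 'X^k)%R <= p)%N.
  rewrite big_seq; apply: (leq_trans (size_sum _ _ _)); apply/bigmax_leqP_seq.
  move=> k; rewrite mem_index_iota => /andP[_ kp] _.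
  by rewrite (leq_trans (size_scale_leq _ _)) // size_polyXn.
have szY (c : nat -> F) : (size (\sum_(1 <= k < p) c k *: (1 - 'X) ^+ k)%R <= p)%N.
  rewrite big_seq; apply: (leq_trans (size_sum _ _ _)); apply/bigmax_leqP_seq.
  move=> k; rewrite mem_index_iota => /andP[_ kp] _.
  rewrite (leq_trans (size_scale_leq _ _)) // (leq_trans (size_exp_leq _ _)) //.
  by move: size1X; case: (size _) => [|[|[|s]]] //=; lia.
have AU : \sum_(1 <= k < p) a k *: 'X^k
    = \sum_(1 <= k < p) (u k.-1 - u k) *: (1 - 'X) ^+ k :> {poly F}.
  apply: (poly_eq_nat_charp charFp) => // k _; rewrite !horner_sum.
  transitivity (\sum_(1 <= i < p) a i * k%:R ^+ i).
    by apply: eq_bigr => i _; rewrite !hornerE.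
  rewrite au -sumrN; apply: eq_bigr => i _.
  by rewrite !hornerE -mulNr opprB.
have dfg : (f - g)^`() = 0.
  have X0 : 'X != 0 :> {poly F} by rewrite polyX_eq0.
  apply: (mulfI X0); rewrite mulr0 derivB mulrBr.
  have -> : 'X * f^`() = \sum_(1 <= k < p) a k *: 'X^k.
    rewrite raddf_sum mulr_sumr; apply: eq_big_nat => -[//|k] kp /=.
    rewrite derivZ derivXn -scalerAr mulrnAr -exprS -scaler_nat scalerA.
    by rewrite divfK // (natf_neq0_lt charFp).
  have -> : 'X * g^`() = \sum_(1 <= k < p) (u k.-1 - u k) *: (1 - 'X) ^+ k.
    pose v k : {poly F} := u k *: (1 - 'X) ^+ k.
    have : \sum_(1 <= k < p) (v k - v k.-1) = 0.
      by rewrite (sum_nat_telescope v) ?(ltnW p_gt1) // /v u0 up !scale0r subrr.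
    move=> v0; transitivity (\sum_(1 <= k < p)
        ((u k.-1 - u k) *: (1 - 'X) ^+ k + (v k - v k.-1))); last first.
      by rewrite big_split /= v0 addr0.
    rewrite raddf_sum mulr_sumr /v; apply: eq_big_nat => -[//|k] kp /=.
    rewrite derivZ deriv_exp derivB derivX (derivC 1) sub0r /=.
    transitivity (u k *: (- 'X * (1 - 'X) ^+ k)).
      rewrite -scaler_nat scalerA divfK ?(natf_neq0_lt charFp) // -scalerAr.
      by congr (_ *: _); ring.
    rewrite scalerBl addrA subrK -scalerBr exprS; congr (_ *: _); ring.
  by rewrite AU subrr.
(* In characteristic [p] a zero derivative forces a constant only because the degree is below
   [p]. *)
have [c fgc] : exists c, f - g = c%:P.
  exists (f - g)`_0; apply/polyP => -[|i]; rewrite coefC //=.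
  have [ip|ip] := ltnP i.+1 p; last first.
    rewrite nth_default // (leq_trans _ ip) // (leq_trans (size_add _ _)) //.
    by rewrite size_opp geq_max szX szY.
  have := congr1 (fun h : {poly F} => h`_i) dfg; rewrite coef_deriv coef0 -mulr_natr => /eqP.
  by rewrite mulf_eq0 (negPf (natf_neq0_lt charFp _)) ?orbF //= => /eqP.
have fgE := canRL (subrK _) fgc.
(* The constant is found at 1, where every term of [g] vanishes. *)
have -> : \sum_(1 <= k < p) a k / k%:R = c.
  transitivity f.[1].
    by rewrite fE; apply: eq_bigr => k _; rewrite expr1n mulr1.
  rewrite fgE hornerD hornerC gE big1_seq ?addr0 //.
  move=> k; rewrite mem_index_iota => /andP[_ /andP[k0 _]].
  by rewrite subrr expr0n gtn_eqF // mulr0.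
by rewrite -fE {1}fgE hornerD hornerC gE addrC.
Qed.

End Duality.

(** * Evaluation of the weight 3 sums *)

Section WeightThree.
Variables (F : fieldType) (p : nat).
Hypotheses (charFp : p \in [pchar F]) (p_gt5 : (5 < p)%N).
Variable B : F.
Hypothesis sumH_div2 : \sum_(1 <= k < p) harm F 1 k / k%:R ^+ 2 = B.
Hypothesis alt_div3 : \sum_(1 <= k < p) (-1) ^+ k / k%:R ^+ 3 = - B / 2%:R.

Local Notation H := (harm F 1).
Local Notation G := (harm F 2).
Local Notation polylog s x := (\sum_(1 <= k < p) x ^+ k / k%:R ^+ s).

Let nz2 : 2%:R != 0 :> F. Proof. by apply: (natf_neq0_lt charFp); lia. Qed.
Let nz4 : 4%:R != 0 :> F. Proof. by apply: (natf_neq0_lt charFp); lia. Qed.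
Let nz8 : 8%:R != 0 :> F. Proof. by rewrite (natrX F 2 3) expf_neq0. Qed.
Let nzk k : (0 < k < p)%N -> k%:R != 0 :> F := natf_neq0_lt charFp (k := k).

Let p_odd : odd p := charp_odd charFp (ltn_trans (isT : 2 < 5)%N p_gt5).

(** Integrates [polylog1_dual], with [u = - H]; the constant of integration is
    [harm F 2 p.-1 = 0]. *)
Lemma polylog2_dual x :
  polylog 2 x = - \sum_(1 <= k < p) (1 - x) ^+ k * H k.-1 / k%:R.
Proof.
have p0 : (0 < p)%N by lia.
have := polylog_dual_step charFp (a := fun k => k%:R^-1) (u := fun k => - H k).
move=> /(_ _ _ _ x) E.
have {}E : \sum_(1 <= k < p) k%:R^-1 / k%:R * x ^+ k =
    \sum_(1 <= k < p) - H k.-1 / k%:R * (1 - x) ^+ k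
    + \sum_(1 <= k < p) k%:R^-1 / k%:R.
  apply: E => [||y]; first by rewrite harm0 oppr0.
    by rewrite (harm_charp0 charFp) ?oppr0 //; lia.
  transitivity (\sum_(1 <= k < p) y ^+ k / k%:R).
    by apply: eq_bigr => k _; rewrite mulrC.
  rewrite (polylog1_dual charFp); last by lia.
  rewrite -sumrN; apply: eq_big_nat => k kp; rewrite harm_pred; last by lia.
  by rewrite expr1; ring.
have h2 : \sum_(1 <= k < p) k%:R^-1 / k%:R = 0 :> F.
  rewrite -[RHS](harm_charp0 charFp (s := 2)) /harm ?prednK //; last by lia.
  by apply: eq_bigr => k _; rewrite -invfM.
rewrite h2 addr0 in E; rewrite -sumrN.
transitivity (\sum_(1 <= k < p) k%:R^-1 / k%:R * x ^+ k).
  by apply: eq_bigr => k _; rewrite -invfM mulrC.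
by rewrite E; apply: eq_bigr => k _; ring.
Qed.

(** Integrates [polylog2_dual]. The increments [H k.-1 / k] found there sum to the second elementary
    symmetric function of [1, 1/2, ..., 1/k], which is [(H k ^+ 2 - G k) / 2]. *)
Lemma polylog3_dual x :
  polylog 3 x = \sum_(1 <= k < p) (1 - x) ^+ k * ((H k.-1 ^+ 2 - G k.-1) / 2%:R) / k%:R.
Proof.
have p0 : (0 < p)%N by lia.
have := polylog_dual_step charFp (a := fun k => (k%:R ^+ 2)^-1)
  (u := fun k => (H k ^+ 2 - G k) / 2%:R).
move=> /(_ _ _ _ x) E.
have {}E : \sum_(1 <= k < p) (k%:R ^+ 2)^-1 / k%:R * x ^+ k =
    \sum_(1 <= k < p) (H k.-1 ^+ 2 - G k.-1) / 2%:R / k%:R * (1 - x) ^+ k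
    + \sum_(1 <= k < p) (k%:R ^+ 2)^-1 / k%:R.
  apply: E => [||y]; first by rewrite !harm0; ring.
    by rewrite !(harm_charp0 charFp); [ring|lia..].
  transitivity (polylog 2 y).
    by apply: eq_bigr => k _; rewrite mulrC.
  rewrite polylog2_dual; congr (- _); apply: eq_big_nat => k kp.
  have nz := nzk kp; rewrite !harm_pred; try lia.
  by rewrite expr1; field; rewrite nz2.
have h3 : \sum_(1 <= k < p) (k%:R ^+ 2)^-1 / k%:R = 0 :> F.
  rewrite -[RHS](harm_charp0 charFp (s := 3)) /harm ?prednK //; last by lia.
  by apply: eq_bigr => k _; rewrite -invfM -exprSr.
rewrite h3 addr0 in E.
transitivity (\sum_(1 <= k < p) (k%:R ^+ 2)^-1 / k%:R * x ^+ k).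
  by apply: eq_bigr => k _; rewrite -invfM -exprSr mulrC.
by rewrite E; apply: eq_bigr => k _; ring.
Qed.

(** Integrates [polylog2_dual] read in the variable [1 - x], with [u = G]. The constant of
    integration is now [B], because the sum of [1 / k ^ 3] vanishes. *)
Lemma sum_harm_div2_dual x :
  \sum_(1 <= k < p) x ^+ k * H k.-1 / k%:R ^+ 2
    = \sum_(1 <= k < p) (1 - x) ^+ k * G k.-1 / k%:R + B.
Proof.
have p0 : (0 < p)%N by lia.
have := polylog_dual_step charFp (a := fun k => H k.-1 / k%:R) (u := fun k => G k).
move=> /(_ _ _ _ x) E.
have {}E : \sum_(1 <= k < p) H k.-1 / k%:R / k%:R * x ^+ k =
    \sum_(1 <= k < p) G k.-1 / k%:R * (1 - x) ^+ k
    + \sum_(1 <= k < p) H k.-1 / k%:R / k%:R.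
  apply: E => [||y]; first by rewrite harm0.
    by rewrite (harm_charp0 charFp) //; lia.
  have := polylog2_dual (1 - y); rewrite subKr => E2.
  transitivity (- polylog 2 (1 - y)).
    by rewrite E2 opprK; apply: eq_bigr => k _; ring.
  congr (- _); apply: eq_big_nat => k kp; rewrite harm_pred; last by lia.
  by ring.
have hB : \sum_(1 <= k < p) H k.-1 / k%:R / k%:R = B.
  have h3 : \sum_(1 <= k < p) (k%:R ^+ 3)^-1 = 0 :> F.
    by rewrite -[RHS](harm_charp0 charFp (s := 3)) /harm ?prednK //; lia.
  transitivity (\sum_(1 <= k < p) (H k / k%:R ^+ 2 - (k%:R ^+ 3)^-1)); last first.
    by rewrite big_split /= sumrN h3 subr0.
  apply: eq_big_nat => k kp.
  have nz := nzk kp; rewrite harm_pred ?expr1; last by lia.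
  by field.
rewrite hB in E.
transitivity (\sum_(1 <= k < p) H k.-1 / k%:R / k%:R * x ^+ k).
  by apply: eq_big_nat => k kp; have nz := nzk kp; field.
by rewrite E; congr (_ + _); apply: eq_bigr => k _; ring.
Qed.

(** As [p] is odd, [k -> p - k] changes the sign of every term. *)
Lemma polylog2_N1 : polylog 2 (-1) = 0 :> F.
Proof.
apply: (mulfI nz2); rewrite mulr0 mulr2n mulrDl mul1r {1}sum_nat_rev -big_split /=.
rewrite big1_seq // => k; rewrite mem_index_iota => /andP[_ kp].
rewrite signr_subn_odd ?(natf_subp_expV charFp); try lia.
by ring.
Qed.

(** Reflection turns [H k.-1] into [H k] and flips the sign, so the sum [s] satisfies
    [s = - s - L_3(-1)]. The next lemma has the same equation. *)
Lemma sum_alt_harm1 : \sum_(1 <= k < p) (-1) ^+ k * H k.-1 / k%:R ^+ 2 = B / 4%:R.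
Proof.
suff E : \sum_(1 <= k < p) (-1) ^+ k * H k.-1 / k%:R ^+ 2
     = - \sum_(1 <= k < p) (-1) ^+ k * H k.-1 / k%:R ^+ 2 - polylog 3 (-1).
  move: E; rewrite alt_div3; move: (\sum_(1 <= k < p) _) => s E.
  apply: (mulfI nz2); have -> : 2%:R * s = s + s by ring.
  by rewrite {1}E; field; rewrite nz2 nz4.
rewrite {1}sum_nat_rev -sumrN -sumrB; apply: eq_big_nat => k kp.
have nz := nzk kp.
rewrite signr_subn_odd ?(harm_reflect_pred charFp) ?(natf_subp_expV charFp) //; try lia.
rewrite harm_pred; last by lia.
by rewrite expr1; field.
Qed.

Lemma sum_alt_harm2 : \sum_(1 <= k < p) (-1) ^+ k * G k.-1 / k%:R = B / 4%:R.
Proof.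
suff E : \sum_(1 <= k < p) (-1) ^+ k * G k.-1 / k%:R
     = - \sum_(1 <= k < p) (-1) ^+ k * G k.-1 / k%:R - polylog 3 (-1).
  move: E; rewrite alt_div3; move: (\sum_(1 <= k < p) _) => s E.
  apply: (mulfI nz2); have -> : 2%:R * s = s + s by ring.
  by rewrite {1}E; field; rewrite nz2 nz4.
rewrite {1}sum_nat_rev -sumrN -sumrB; apply: eq_big_nat => k kp.
have nz := nzk kp.
rewrite signr_subn_odd ?(harm_reflect_pred charFp) ?(natf_subp charFp) //; try lia.
rewrite harm_pred; last by lia.
by field; rewrite ?oppr_eq0 nz.
Qed.

(** The duality at -1 kills the sum with weight [H k.-1]; passing to [H k] costs [L_2(2)]. The next
    three lemmas proceed alike, using a duality at 2 or at -1. *)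
Lemma sum_2harm_div : \sum_(1 <= k < p) 2%:R ^+ k * H k / k%:R = polylog 2 2%:R.
Proof.
have := polylog2_dual (-1); rewrite (_ : 1 - -1 = 2%:R); last by ring.
rewrite polylog2_N1 => /esym/eqP; rewrite oppr_eq0 => /eqP E.
transitivity (polylog 2 2%:R + \sum_(1 <= k < p) 2%:R ^+ k * H k.-1 / k%:R); last first.
  by rewrite E addr0.
rewrite -big_split /=; apply: eq_big_nat => k kp; have nz := nzk kp.
by rewrite harm_pred ?expr1; [field|lia].
Qed.

Lemma sum_2harm_div2 :
  \sum_(1 <= k < p) 2%:R ^+ k * H k / k%:R ^+ 2 = polylog 3 2%:R + 5%:R / 4%:R * B.
Proof.
have := sum_harm_div2_dual 2%:R; rewrite (_ : 1 - 2%:R = -1); last by ring.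
rewrite sum_alt_harm2 => E.
transitivity (polylog 3 2%:R + \sum_(1 <= k < p) 2%:R ^+ k * H k.-1 / k%:R ^+ 2).
  rewrite -big_split /=; apply: eq_big_nat => k kp; have nz := nzk kp.
  by rewrite harm_pred ?expr1; [field|lia].
by rewrite E; field.
Qed.

Lemma sum_2harm2_div :
  \sum_(1 <= k < p) 2%:R ^+ k * G k / k%:R = polylog 3 2%:R - 3%:R / 4%:R * B.
Proof.
have := sum_harm_div2_dual (-1); rewrite (_ : 1 - -1 = 2%:R); last by ring.
rewrite sum_alt_harm1 => /(canLR (addrK _)) E.
transitivity (polylog 3 2%:R + \sum_(1 <= k < p) 2%:R ^+ k * G k.-1 / k%:R).
  rewrite -big_split /=; apply: eq_big_nat => k kp; have nz := nzk kp.
  by rewrite harm_pred ?expr1; [field|lia].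
by rewrite -E; field.
Qed.

Lemma sum_2harmsq_div :
  \sum_(1 <= k < p) 2%:R ^+ k * H k ^+ 2 / k%:R = polylog 3 2%:R + 3%:R / 4%:R * B.
Proof.
have := polylog3_dual (-1); rewrite (_ : 1 - -1 = 2%:R); last by ring.
rewrite alt_div3 => E.
(* This isolates [H k ^+ 2] from [H k.-1 ^+ 2 - G k.-1 = H k ^+ 2 - G k - 2 H k / k + 2 / k ^ 2]. *)
transitivity (\sum_(1 <= k < p) 2%:R ^+ k * G k / k%:R
   + 2%:R * (\sum_(1 <= k < p) 2%:R ^+ k * H k / k%:R ^+ 2 - polylog 3 2%:R
   + \sum_(1 <= k < p) 2%:R ^+ k * ((H k.-1 ^+ 2 - G k.-1) / 2%:R) / k%:R)).
  rewrite -sumrB -big_split /= mulr_sumr -big_split /=.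
  apply: eq_big_nat => k kp; have nz := nzk kp.
  by rewrite !harm_pred ?expr1; [field; rewrite nz nz2|lia..].
by rewrite -E sum_2harm2_div sum_2harm_div2; field; rewrite nz4 nz2.
Qed.

Let harm_suffix s m : (0 < s < p.-1)%N -> (m < p)%N ->
  \sum_(m.+1 <= j < p) (j%:R ^+ s)^-1 = - harm F s m.
Proof.
move=> sp mp; apply/eqP; rewrite -addr_eq0 addrC; apply/eqP.
rewrite -[RHS](harm_charp0 charFp sp) /harm prednK; last by lia.
by rewrite [RHS](big_cat_nat _ (n := m.+1)) //=.
Qed.

(* With [i + j = m] modulo [p], partial fractions give
   [1 / (i j^2) = 1 / (m j^2) + (1 / i + 1 / j) / m^2]. *)
Lemma polylog12_mul :
  polylog 1 2%:R * polylog 2 2%:R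
    = - \sum_(1 <= k < p) 2%:R ^+ k * G k / k%:R
      - 2%:R * \sum_(1 <= k < p) 2%:R ^+ k * H k / k%:R ^+ 2
      - 3%:R * polylog 3 2%:R.
Proof.
pose f (i j : nat) : F := 2%:R ^+ (i + j) / (i%:R * j%:R ^+ 2).
have -> : polylog 1 2%:R * polylog 2 2%:R
    = \sum_(1 <= i < p) \sum_(1 <= j < p) f i j.
  rewrite mulr_suml; apply: eq_bigr => i _; rewrite mulr_sumr.
  by apply: eq_bigr => j _; rewrite /f exprD expr1 invfM mulrACA.
rewrite sum_nat_pairs.
have two_p : 2%:R ^+ p = 2%:R :> F := natf_expp charFp 2.
have -> : \sum_(1 <= j < p) f (p - j)%N j = 0.
  transitivity (- 2%:R * harm F 3 p.-1); last first.
    by rewrite (harm_charp0 charFp) ?mulr0 //; lia.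
  rewrite /harm prednK ?mulr_sumr; last by lia.
  apply: eq_big_nat => j jp; have nz := nzk jp.
  rewrite /f subnK ?two_p ?(natf_subp charFp); try lia.
  by field; rewrite oppr_eq0 nz.
have -> : \sum_(1 <= m < p) \sum_(1 <= j < m) f (m - j)%N j
    = \sum_(1 <= m < p) 2%:R ^+ m * (G m.-1 / m%:R + 2%:R * H m.-1 / m%:R ^+ 2).
  apply: eq_big_nat => m mp; have nz := nzk mp.
  have -> : 2%:R * H m.-1 = \sum_(1 <= j < m) (j%:R^-1 + (m - j)%:R^-1).
    rewrite big_split /= -(sum_nat_rev m (fun j => j%:R^-1 : F)).
    have -> : H m.-1 = \sum_(1 <= j < m) j%:R^-1.
      by rewrite /harm prednK; [apply: eq_bigr => j _; rewrite expr1|lia].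
    by ring.
  rewrite /harm prednK; last by lia.
  rewrite !mulr_suml -big_split mulr_sumr /=; apply: eq_big_nat => j jm.
  have nzj : j%:R != 0 :> F by apply: nzk; lia.
  have : (m - j)%:R != 0 :> F by apply: nzk; lia.
  rewrite /f subnK; last by lia.
  rewrite natrB; last by lia.
  by move=> nzmj; field; rewrite nz nzj nzmj.
(* For [i + j = p + m] the partial fractions still hold in [F], the power of 2 doubles by Fermat,
   and the sums over [j > m] are minus those over [j <= m] by [harm_suffix]. *)
have -> : \sum_(1 <= m < p) \sum_(m.+1 <= j < p) f (p + m - j)%N j
    = - (2%:R * \sum_(1 <= m < p) 2%:R ^+ m * (G m / m%:R + 2%:R * H m / m%:R ^+ 2)).
  rewrite mulr_sumr -sumrN; apply: eq_big_nat => m mp; have nz := nzk mp.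
  have mp' : (m < p)%N by lia.
  have e1 : - G m = \sum_(m.+1 <= j < p) (j%:R ^+ 2)^-1 by rewrite harm_suffix //; lia.
  have e2 : - (2%:R * H m) = \sum_(m.+1 <= j < p) (j%:R^-1 + (p + m - j)%:R^-1).
    rewrite big_split /= [X in _ + X]big_nat_rev /=.
    rewrite (eq_big_nat _ _ (F2 := fun j => j%:R^-1 : F)
      (F1 := fun j => (p + m - (m.+1 + p - j.+1))%:R^-1)); last first.
      by move=> j jp; congr (_%:R^-1); lia.
    have -> : \sum_(m.+1 <= j < p) j%:R^-1 = - H m.
      by rewrite -harm_suffix; [apply: eq_bigr => j _; rewrite expr1|lia..].
    by ring.
  transitivity (2%:R * 2%:R ^+ m * ((- G m) / m%:R + (- (2%:R * H m)) / m%:R ^+ 2)); last by ring.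
  rewrite e1 e2 !mulr_suml -big_split mulr_sumr /=; apply: eq_big_nat => j jm.
  have nzj : j%:R != 0 :> F by apply: nzk; lia.
  have : (p + m - j)%:R != 0 :> F by apply: nzk; lia.
  rewrite /f subnK; last by lia.
  rewrite natrB ?natrD ?(pcharf0 charFp) ?add0r; last by lia.
  by rewrite exprD two_p => nzmj; field; rewrite nz nzj nzmj.
rewrite addr0 !mulr_sumr -!sumrN -!big_split /=; apply: eq_big_nat => k kp.
have nz := nzk kp; rewrite !harm_pred ?expr1; [by field|lia..].
Qed.

(* Reflection [k -> p - k]. *)
Lemma sum_harm_div_2pow :
  \sum_(1 <= k < p) H k / (k%:R ^+ 2 * 2%:R ^+ k) = 5%:R / 8%:R * B.
Proof.
transitivity ((\sum_(1 <= k < p) 2%:R ^+ k * H k / k%:R ^+ 2 - polylog 3 2%:R) / 2%:R).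
  rewrite sum_nat_rev -sumrB mulr_suml; apply: eq_big_nat => k kp; have nz := nzk kp.
  rewrite (harm_reflect charFp) ?(natf_subp charFp) ?harm_pred; try lia.
  have z : 2%:R ^+ k != 0 :> F by rewrite expf_neq0.
  have -> : 2%:R ^+ (p - k) = 2%:R / 2%:R ^+ k :> F.
    apply: (mulIf z); rewrite divfK // -exprD subnK ?(natf_expp charFp) //; lia.
  by rewrite expr1; move: z; move: (2%:R ^+ k) => y z; field; rewrite z nz nz2 oppr_eq0 nz.
by rewrite sum_2harm_div2; field; rewrite nz2 nz4 nz8.
Qed.

Lemma sum_harmsq_div_2pow :
  \sum_(1 <= k < p) H k ^+ 2 / (k%:R * 2%:R ^+ k) = 7%:R / 8%:R * B.
Proof.
transitivity (- (\sum_(1 <= k < p) 2%:R ^+ k * H k ^+ 2 / k%:R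
   - 2%:R * \sum_(1 <= k < p) 2%:R ^+ k * H k / k%:R ^+ 2 + polylog 3 2%:R) / 2%:R).
  rewrite mulr_sumr -sumrB -big_split /= -sumrN mulr_suml sum_nat_rev.
  apply: eq_big_nat => k kp; have nz := nzk kp.
  rewrite (harm_reflect charFp) ?(natf_subp charFp) ?harm_pred; try lia.
  have z : 2%:R ^+ k != 0 :> F by rewrite expf_neq0.
  have -> : 2%:R ^+ (p - k) = 2%:R / 2%:R ^+ k :> F.
    apply: (mulIf z); rewrite divfK // -exprD subnK ?(natf_expp charFp) //; lia.
  by rewrite expr1; move: z; move: (2%:R ^+ k) => y z; field; rewrite z nz nz2 oppr_eq0 nz.
by rewrite sum_2harmsq_div sum_2harm_div2; field; rewrite nz2 nz4 nz8.
Qed.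

End WeightThree.

(** * Reduction of p-integral rationals *)

(** For prime [p], the localization of the integers at [p]; membership is by conversion the
    denominator condition of [rat_eqmod]. *)
Definition pint (p : nat) : {pred rat} := fun x => coprimez (denq x) p.

Lemma pint_frac (p : nat) (n d : int) : coprimez d p -> n%:~R / d%:~R \in pint p.
Proof.
rewrite unfold_in; case: divqP => [_|k x _]; first by rewrite (denq_int 0) /coprimez gcd1z.
by rewrite coprimezMl => /andP[].
Qed.

Fact pint_subring_closed (p : nat) : subring_closed (pint p).
Proof.
split=> [|x y xp yp|x y xp yp].
- by rewrite unfold_in (denq_int 1) /coprimez gcd1z.
- rewrite -[x]divq_num_den -[y]divq_num_den -mulNr addf_div ?intr_eq0 ?denq_neq0 //.
  rewrite -rmorphN -!rmorphM -rmorphD pint_frac // coprimezMl.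
  by apply/andP; split.
- rewrite -[x]divq_num_den -[y]divq_num_den mulf_div -!rmorphM pint_frac // coprimezMl.
  by apply/andP; split.
Qed.

HB.instance Definition _ (p : nat) :=
  GRing.isSubringClosed.Build rat (pint p) (pint_subring_closed p).

Lemma pint_sum_nat (p a c : nat) (f : nat -> rat) :
  (forall k, (a <= k < c)%N -> f k \in pint p) ->
  \sum_(a <= k < c) f k \in pint p.
Proof.
by move=> fp; rewrite big_nat; apply: rpred_sum => k kp; apply: fp.
Qed.

Lemma pint_natV (p n : nat) : coprime n p -> n%:R^-1 \in pint p.
Proof. by move=> np; have := @pint_frac p 1 n np; rewrite mul1r. Qed.

Section Reduction.
Variables (F : fieldType) (p : nat).
Hypothesis charFp : p \in [pchar F].

Let p_prime : prime p := pcharf_prime charFp.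

Lemma coprime_lt (k : nat) : (0 < k < p)%N -> coprime k p.
Proof.
by case/andP=> k0 kp; rewrite coprime_sym prime_coprime // gtnNdvd.
Qed.

Let intr_neq0 (d : int) : coprimez d p -> d%:~R != 0 :> F.
Proof.
rewrite -(dvdz_pcharf charFp) coprimez_sym coprimezE => pd.
by rewrite dvdzE /= -prime_coprime.
Qed.

(** In characteristic [p] the map [ratr] is a ring morphism only on [pint p]. This computes it on
    fractions not in lowest terms, since the cancelled factor also divides [d] and so is nonzero in
    [F]. *)
Lemma ratr_frac (n d : int) : coprimez d p -> ratr (n%:~R / d%:~R) = n%:~R / d%:~R :> F.
Proof.
rewrite /ratr; case: divqP => [_|k x _].
  by rewrite coprimezE /= /coprime gcd0n => /eqP p1; move: p_prime; rewrite p1.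
rewrite coprimezMl => /andP[/intr_neq0 k0 /intr_neq0 x0].
by rewrite !rmorphM /= -mulf_div divff ?mul1r.
Qed.

Lemma ratr_pintD x y : x \in pint p -> y \in pint p -> ratr (x + y) = ratr x + ratr y :> F.
Proof.
move=> xp yp; rewrite -[x in LHS]divq_num_den -[y in LHS]divq_num_den.
rewrite addf_div ?intr_eq0 ?denq_neq0 // -!rmorphM -rmorphD ratr_frac; last first.
  by rewrite coprimezMl; apply/andP; split.
by rewrite /ratr addf_div ?intr_neq0 // rmorphD !rmorphM.
Qed.

Lemma ratr_pintM x y : x \in pint p -> y \in pint p -> ratr (x * y) = ratr x * ratr y :> F.
Proof.
move=> xp yp; rewrite -[x in LHS]divq_num_den -[y in LHS]divq_num_den.
rewrite mulf_div -!rmorphM ratr_frac; last by rewrite coprimezMl; apply/andP; split.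
by rewrite /ratr mulf_div !rmorphM.
Qed.

Lemma ratrN_field (x : rat) : ratr (- x) = - ratr x :> F.
Proof. by rewrite /ratr numqN denqN rmorphN mulNr. Qed.

Lemma ratr_pintX x n : x \in pint p -> ratr (x ^+ n) = ratr x ^+ n :> F.
Proof.
move=> xp; elim: n => [|n IHn]; first by rewrite !expr0 (ratr_nat _ 1).
by rewrite !exprS ratr_pintM ?rpredX // IHn.
Qed.

Lemma ratr_natV n : coprime n p -> ratr n%:R^-1 = n%:R^-1 :> F.
Proof. by move=> np; have := @ratr_frac 1 n np; rewrite !mul1r. Qed.

Lemma ratr_pint_sum_nat (a c : nat) (f : nat -> rat) :
  (forall k, (a <= k < c)%N -> f k \in pint p) ->
  ratr (\sum_(a <= k < c) f k) = \sum_(a <= k < c) ratr (f k) :> F.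
Proof.
move=> fp; have [ca|ac] := leqP c a; first by rewrite !big_geq // (ratr_nat _ 0).
elim: c ac fp => // c IHc ac fp; rewrite !big_nat_recr //=.
rewrite ratr_pintD; last by apply: fp; lia.
  have [ca|{}ac] := leqP c a; first by rewrite !big_geq // (ratr_nat _ 0).
  by rewrite IHc // => k /andP[ak kc]; rewrite fp // ak ltnW.
by apply: pint_sum_nat => k /andP[ak kc]; rewrite fp // ak ltnW.
Qed.

Lemma ratr_eq0_pint x : x \in pint p -> ratr x = 0 :> F ->
  exists2 r, r \in pint p & x = p%:R * r.
Proof.
move=> xp /eqP; rewrite mulf_eq0 invr_eq0 (negPf (intr_neq0 xp)) orbF.
rewrite -(dvdz_pcharf charFp) => /dvdzP[n En]; exists (n%:~R / (denq x)%:~R).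
  exact: pint_frac.
by rewrite -[LHS]divq_num_den En rmorphM /= mulrCA mulrA.
Qed.

Lemma ratr_eq_pint x y : x \in pint p -> y \in pint p -> ratr x = ratr y :> F ->
  exists2 r, r \in pint p & x = y + p%:R * r.
Proof.
move=> xp yp E; have [||r rp Er] := @ratr_eq0_pint (x - y).
- by rewrite rpredB.
- by rewrite ratr_pintD ?rpredN // ratrN_field E subrr.
by exists r; rewrite // -Er addrC subrK.
Qed.

Lemma pint_harm s k : (k < p)%N -> harm rat s k \in pint p.
Proof.
move=> kp; apply: pint_sum_nat => i ik; rewrite -natrX pint_natV // coprimeXl //.
by apply: coprime_lt; lia.
Qed.

Lemma ratr_harm s k : (k < p)%N -> ratr (harm rat s k) = harm F s k.
Proof.
move=> kp; rewrite ratr_pint_sum_nat.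
  apply: eq_big_nat => i ik; rewrite -natrX ratr_natV ?natrX // coprimeXl //.
  by apply: coprime_lt; lia.
move=> i ik; rewrite -natrX pint_natV // coprimeXl //.
by apply: coprime_lt; lia.
Qed.

(** Solving the recurrence for [bernoulli k] divides only by [k + 1 < p]. *)
Lemma pint_bernoulli k : (k < p.-1)%N -> bernoulli k \in pint p.
Proof.
elim/ltn_ind: k => -[_ _|k IHk kp]; first by rewrite bernoulli0 rpred1.
have := bernoulli_rec (ltn0Sn k); rewrite big_ord_recr /= binSn => /eqP.
rewrite addrC addr_eq0 => /eqP E.
have nz : k.+2%:R != 0 :> rat by rewrite pnatr_eq0.
rewrite -(mulKf nz (bernoulli _)) E rpredM ?pint_natV ?rpredN //.
  by apply: coprime_lt; lia.
apply: rpred_sum => i _; rewrite rpredM ?rpred_nat // IHk //.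
by have := ltn_ord i; lia.
Qed.

Lemma ratr_bernoulli_rec n : (0 < n < p.-1)%N ->
  \sum_(k < n.+1) 'C(n.+1, k)%:R * ratr (bernoulli k) = 0 :> F.
Proof.
case/andP=> n0 np.
have E : ratr (\sum_(k < n.+1) 'C(n.+1, k)%:R * bernoulli k) = 0 :> F.
  by rewrite bernoulli_rec // (ratr_nat _ 0).
rewrite -[RHS]E.
rewrite -(big_mkord xpredT (fun k => 'C(n.+1, k)%:R * ratr (bernoulli k))).
rewrite -(big_mkord xpredT (fun k => 'C(n.+1, k)%:R * bernoulli k)).
rewrite ratr_pint_sum_nat => [|k kp].
  apply: eq_big_nat => k kp; rewrite ratr_pintM ?ratr_nat ?rpred_nat //.
  by apply: pint_bernoulli; lia.
by rewrite rpredM ?rpred_nat // pint_bernoulli //; lia.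
Qed.

(** Integrality travels with the value, because [ratr] respects sums and products only on [pint p];
    reductions can then follow the structure of a term. *)
Definition reduces_to (x : rat) (y : F) : Prop := x \in pint p /\ ratr x = y.

Lemma reduces_toD x1 y1 x2 y2 : reduces_to x1 y1 -> reduces_to x2 y2 ->
  reduces_to (x1 + x2) (y1 + y2).
Proof. by move=> [p1 <-] [p2 <-]; split; rewrite ?rpredD // ratr_pintD. Qed.

Lemma reduces_toN x y : reduces_to x y -> reduces_to (- x) (- y).
Proof. by move=> [px <-]; split; rewrite ?rpredN // ratrN_field. Qed.

Lemma reduces_toM x1 y1 x2 y2 : reduces_to x1 y1 -> reduces_to x2 y2 ->
  reduces_to (x1 * x2) (y1 * y2).
Proof. by move=> [p1 <-] [p2 <-]; split; rewrite ?rpredM // ratr_pintM. Qed.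

Lemma reduces_toX x y n : reduces_to x y -> reduces_to (x ^+ n) (y ^+ n).
Proof. by move=> [px <-]; split; rewrite ?rpredX // ratr_pintX. Qed.

Lemma reduces_to_nat n : reduces_to n%:R n%:R.
Proof. by split; rewrite ?rpred_nat // ratr_nat. Qed.

Lemma reduces_to_natV n : coprime n p -> reduces_to n%:R^-1 n%:R^-1.
Proof. by move=> np; split; [apply: pint_natV|apply: ratr_natV]. Qed.

Lemma reduces_to_harm s k : (k < p)%N -> reduces_to (harm rat s k) (harm F s k).
Proof. by move=> kp; split; [apply: pint_harm|apply: ratr_harm]. Qed.

Lemma reduces_to_sum_nat (a c : nat) (f : nat -> rat) (g : nat -> F) :
  (forall k, (a <= k < c)%N -> reduces_to (f k) (g k)) ->
  reduces_to (\sum_(a <= k < c) f k) (\sum_(a <= k < c) g k).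
Proof.
move=> fg; split; first by apply: pint_sum_nat => k /fg[].
by rewrite ratr_pint_sum_nat => [|k /fg[]//]; apply: eq_big_nat => k /fg[].
Qed.

Lemma reduces_to_eq x y z : reduces_to x y -> reduces_to x z -> y = z.
Proof. by move=> [_ <-] []. Qed.

Lemma reduces_to_lift x y z : reduces_to x z -> reduces_to y z ->
  exists2 r, r \in pint p & x = y + p%:R * r.
Proof. by move=> [xp xz] [yp yz]; apply: ratr_eq_pint; rewrite // xz. Qed.

Lemma rat_eqmod_reduces_to x y z : reduces_to x z -> reduces_to y z -> rat_eqmod p 1 x y.
Proof.
move=> xz /(reduces_to_lift xz)[r rp ->]; exists r => //.
by rewrite expr1 addrAC subrr add0r.
Qed.

End Reduction.

(** * Congruences modulo p^2 *)

(* Since [(-1) ^ k * C(p - 1, k) = prod_(i <= k) (1 - p / i)], this is [p]-integral. *)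
Definition bin_pred_error (p k : nat) : rat :=
  ((-1) ^+ k * 'C(p.-1, k)%:R - 1 + p%:R * harm rat 1 k) / p%:R ^+ 2.

Section Supercongruence.
Variable p : nat.
Hypotheses (p_prime : prime p) (p_gt5 : (5 < p)%N).

Local Notation F := 'F_p.
Local Notation H := (harm rat 1).
Local Notation G := (harm rat 2).
Local Notation polylog s x := (\sum_(1 <= k < p) x ^+ k / k%:R ^+ s).
Local Notation q := (fermat_quotient2 p).

Let charFp : p \in [pchar F] := pchar_Fp p_prime.

Let p_gt0 : (0 < p)%N := prime_gt0 p_prime.

Let p_odd : odd p := charp_odd charFp (ltn_trans (isT : 2 < 5)%N p_gt5).

Let natr_p_neq0 : p%:R != 0 :> rat.
Proof. by rewrite pnatr_eq0; lia. Qed.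

Let natr_neq0 k : (0 < k)%N -> k%:R != 0 :> rat.
Proof. by rewrite pnatr_eq0; lia. Qed.

Let pintV k : (0 < k < p)%N -> k%:R^-1 \in pint p.
Proof. by move=> kp; apply: pint_natV; apply: (coprime_lt charFp). Qed.

Let pintVB k : (0 < k < p)%N -> (p%:R - k%:R)^-1 \in pint p.
Proof. by move=> kp; rewrite -natrB; [apply: pintV; lia|lia]. Qed.

Let pintH s k : (k < p)%N -> harm rat s k \in pint p.
Proof. exact: (pint_harm charFp). Qed.

Ltac pint :=
  match goal with
  | |- is_true (in_mem (@Algebra.add _ _ _) _) => apply: rpredD; pint
  | |- is_true (in_mem (@Algebra.opp _ _) _) => rewrite rpredN; pint
  | |- is_true (in_mem (@GRing.mul _ _ _) _) => apply: rpredM; pint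
  | |- is_true (in_mem (@GRing.exp _ _ _) _) => apply: rpredX; pint
  | |- is_true (in_mem (GRing.one _) _) => apply: rpred1
  | |- is_true (in_mem (@Algebra.natmul _ _ _) _) => apply: rpred_nat
  | |- is_true (in_mem (harm _ _ _) _) => apply: pintH; lia
  | |- is_true (in_mem (@GRing.inv _ (@GRing.mul _ _ _)) _) => rewrite invfM; pint
  | |- is_true (in_mem (@GRing.inv _ (@GRing.exp _ _ _)) _) => rewrite -exprVn; pint
  | |- is_true (in_mem (@GRing.inv _ (@Algebra.natmul _ _ _)) _) => apply: pintV; lia
  | |- is_true (in_mem (@GRing.inv _ (@Algebra.add _ _ _)) _) => apply: pintVB; lia
  | |- is_true (in_mem (@bigop.body _ _ _ _ _) _) =>
      let k := fresh "k" in let kp := fresh "kp" in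
      apply: pint_sum_nat => k kp; pint
  | _ => try assumption
  end.

Lemma fermat_quotient2E : 2%:R ^+ p = 2%:R + 2%:R * p%:R * q :> rat.
Proof.
rewrite /fermat_quotient2 -[p in LHS]prednK // exprS.
by field.
Qed.

Lemma pint_fermat_quotient2 : q \in pint p.
Proof.
have [|| r rp E] := @ratr_eq0_pint F p charFp (2%:R ^+ p.-1 - 1).
- by rewrite rpredB ?rpredX ?rpred_nat ?rpred1.
- have -> : 2%:R ^+ p.-1 - 1 = (2 ^ p.-1)%:R - 1%:R :> rat by rewrite natrX.
  rewrite (ratr_pintD charFp) ?rpredN ?rpred_nat // (ratrN_field F).
  by rewrite !ratr_nat natrX (natf_exp_pred charFp) ?subrr //; lia.
by rewrite /fermat_quotient2 E mulrAC divff ?mul1r.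
Qed.

Local Notation c2 := (bin_pred_error p).

Let c2E k : (-1) ^+ k * 'C(p.-1, k)%:R = 1 - p%:R * H k + p%:R ^+ 2 * c2 k.
Proof. by rewrite /bin_pred_error; field. Qed.

(** Multiplying the product by its next factor [1 - p / (k + 1)] gives a recursion for the error
    whose terms are all [p]-integral. *)
Let pint_c2 k : (k < p)%N -> c2 k \in pint p.
Proof.
elim: k => [|k IHk] kp.
  have -> : c2 0 = 0 by rewrite /bin_pred_error harm0 bin0; ring.
  exact: rpred0.
have nz : k.+1%:R != 0 :> rat by rewrite pnatr_eq0.
have E : 'C(p.-1, k.+1)%:R = (p%:R - k.+1%:R) / k.+1%:R * 'C(p.-1, k)%:R :> rat.
  apply: (mulfI nz); rewrite -natrM mul_bin_left natrM natrB; last by lia.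
  rewrite -subn1 natrB // -[k.+1%:R]natr1.
  by move: nz; rewrite -natr1 => nz; field.
have -> : c2 k.+1 = c2 k * (1 - p%:R / k.+1%:R) + H k / k.+1%:R.
  rewrite {1}/bin_pred_error exprS E harmS expr1.
  have -> : -1 * (-1) ^+ k * ((p%:R - k.+1%:R) / k.+1%:R * 'C(p.-1, k)%:R)
    = (1 - p%:R / k.+1%:R) * ((-1) ^+ k * 'C(p.-1, k)%:R) :> rat.
    by move: (k.+1%:R) nz => y nz; field.
  by rewrite c2E; move: (k.+1%:R) nz {E} => y nz; field; rewrite nz natr_p_neq0.
have pk := pintV (k := k.+1) kp.
have c2p := IHk (ltnW kp).
by pint.
Qed.

Lemma sum_bin_pred (f : nat -> rat) : (forall k, (0 < k < p)%N -> f k \in pint p) ->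
  exists2 r, r \in pint p &
    \sum_(1 <= k < p) (-1) ^+ k * 'C(p.-1, k)%:R * f k
      = \sum_(1 <= k < p) f k - p%:R * \sum_(1 <= k < p) H k * f k + p%:R ^+ 2 * r.
Proof.
move=> fp; exists (\sum_(1 <= k < p) c2 k * f k).
  by apply: pint_sum_nat => k kp; rewrite rpredM ?fp ?pint_c2 //; lia.
rewrite !mulr_sumr -sumrB -big_split /=; apply: eq_bigr => k _.
by rewrite c2E; ring.
Qed.

(** Each of the two divisions by [k] is one use of [binomial_transform_div]. *)
Lemma binomial_transform_div2 (x : rat) (n : nat) :
  \sum_(1 <= k < n.+1) 'C(n, k)%:R * (- x) ^+ k / k%:R ^+ 2
    = \sum_(1 <= m < n.+1) m%:R^-1 * \sum_(1 <= j < m.+1) ((1 - x) ^+ j - 1) / j%:R.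
Proof.
transitivity (\sum_(1 <= k < n.+1) 'C(n, k)%:R * ((- x) ^+ k / k%:R) / k%:R).
  by apply: eq_bigr => k _; rewrite -!mulrA -invfM.
rewrite binomial_transform_div => [|k /andP[k0 _]]; last exact: natr_neq0.
apply: eq_bigr => m _; congr (_ * _).
under eq_bigr => k _ do rewrite mulrA.
rewrite binomial_transform_div => [|k /andP[k0 _]]; last exact: natr_neq0.
by apply: eq_bigr => j _; rewrite sum_binomial_pow mulrC.
Qed.

Lemma sum_harm_div_sq :
  \sum_(1 <= m < p) H m / m%:R = (H p.-1 ^+ 2 + G p.-1) / 2%:R.
Proof.
have := sum_nat_telescope (fun k => (H k ^+ 2 + G k) / 2%:R) p_gt0.
rewrite !harm0 expr0n add0r mul0r subr0 => <-; apply: eq_big_nat => k kp.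
have nz : k%:R != 0 :> rat by apply: natr_neq0; lia.
by rewrite !harm_pred ?expr1; [field|lia..].
Qed.

(** The double transform with [n = p - 1] at [x = 1], where its inner sum is [- H m]. It serves to
    find [G p.-1] modulo [p ^ 2]. *)
Lemma bin_transform_at1 : exists2 r, r \in pint p &
  G p.-1 - p%:R * \sum_(1 <= k < p) H k / k%:R ^+ 2 + p%:R ^+ 2 * r
    = - (H p.-1 ^+ 2 + G p.-1) / 2%:R.
Proof.
have [k kp|r rp E] := sum_bin_pred (f := fun k => (k%:R ^+ 2)^-1).
  by rewrite -exprVn rpredX ?pintV.
exists r => //; rewrite mulNr -sum_harm_div_sq.
have GE : G p.-1 = \sum_(1 <= k < p) (k%:R ^+ 2)^-1 by rewrite /harm prednK.
rewrite GE -E; have := binomial_transform_div2 1 p.-1; rewrite prednK // subrr.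
have -> : \sum_(1 <= k < p) (-1) ^+ k * 'C(p.-1, k)%:R / k%:R ^+ 2
   = \sum_(1 <= k < p) 'C(p.-1, k)%:R * (-1) ^+ k / k%:R ^+ 2 :> rat.
  by apply: eq_bigr => k _; congr (_ / _); rewrite mulrC.
move=> ->; rewrite -sumrN; apply: eq_big_nat => m mp.
rewrite mulrC -mulNr; congr (_ / _); rewrite -sumrN; apply: eq_big_nat => j jm.
by rewrite expr0n gtn_eqF ?sub0r ?mulN1r ?expr1 //; lia.
Qed.

(** The double transform at [x = -1], where the inner sum is a partial sum of [L_1(2)] minus [H m].
    It serves to find the sum of [2 ^ k H_{k-1} / k] modulo [p ^ 2]. *)
Lemma bin_transform_atN1 : exists2 r, r \in pint p &
  polylog 2 (-1) - p%:R * \sum_(1 <= k < p) (-1) ^+ k * H k / k%:R ^+ 2 + p%:R ^+ 2 * r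
    = H p.-1 * polylog 1 2%:R - \sum_(1 <= k < p) 2%:R ^+ k * H k.-1 / k%:R
      - (H p.-1 ^+ 2 + G p.-1) / 2%:R.
Proof.
have [k kp|r rp E] := sum_bin_pred (f := fun k => (-1) ^+ k / k%:R ^+ 2).
  by pint.
exists r => //; rewrite -sum_harm_div_sq.
have -> : \sum_(1 <= k < p) (-1) ^+ k * H k / k%:R ^+ 2
    = \sum_(1 <= k < p) H k * ((-1) ^+ k / k%:R ^+ 2).
  by apply: eq_bigr => k _; ring.
rewrite -E; have := binomial_transform_div2 (-1) p.-1.
rewrite prednK // (_ : 1 - -1 = 2%:R); last by ring.
have -> : \sum_(1 <= k < p) (-1) ^+ k * 'C(p.-1, k)%:R * ((-1) ^+ k / k%:R ^+ 2)
   = \sum_(1 <= k < p) 'C(p.-1, k)%:R * (- -1) ^+ k / k%:R ^+ 2 :> rat.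
  apply: eq_bigr => k _; rewrite opprK expr1n mulr1 mulrA; congr (_ / _).
  by rewrite mulrAC -exprD addnn -signr_odd odd_double mul1r.
move=> ->.
pose W m : rat := \sum_(1 <= j < m.+1) 2%:R ^+ j / j%:R ^+ 1.
have WE : W p.-1 = polylog 1 2%:R by rewrite /W prednK.
(* Summation by parts: the increments are [W m / m + 2 ^ m * H m.-1 / m]. *)
have := sum_nat_telescope (fun k => H k * W k) p_gt0.
rewrite harm0 mul0r subr0 WE => <-.
rewrite -!sumrB; apply: eq_big_nat => m mp.
have nz : m%:R != 0 :> rat by apply: natr_neq0; lia.
have -> : \sum_(1 <= j < m.+1) (2%:R ^+ j - 1) / j%:R = W m - H m.
  by rewrite /W /harm -sumrB; apply: eq_bigr => j _; rewrite expr1 mulrBl mul1r.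
have -> : W m.-1 = W m - 2%:R ^+ m / m%:R.
  by case: m mp {nz} => [|m] mp; [lia|rewrite /W [in RHS]big_nat_recr //= expr1 addrK].
by rewrite harm_pred ?expr1; [field|lia].
Qed.

(** Pair [k] with [p - k] and expand [1 / (p - k)] as [- 1/k - p/k^2 - p^2/k^3] with remainder
    [p^3 / (k^3 (p - k))]; the cubic sum is itself divisible by [p]. *)
Lemma harm1_pred_p : exists2 r, r \in pint p &
  H p.-1 = - p%:R * G p.-1 / 2%:R + p%:R ^+ 3 * r.
Proof.
have [||t tp Et] := @ratr_eq0_pint F p charFp (harm rat 3 p.-1).
- by apply: pintH; lia.
- by rewrite (ratr_harm charFp) ?(harm_charp0 charFp) //; lia.
pose v := \sum_(1 <= k < p) (k%:R ^+ 3 * (p%:R - k%:R))^-1 : rat.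
have vp : v \in pint p.
  by rewrite /v; pint.
exists ((v - t) / 2%:R); first by pint.
have sE s : harm rat s p.-1 = \sum_(1 <= k < p) (k%:R ^+ s)^-1 by rewrite /harm prednK.
have E : H p.-1 + H p.-1
    = - p%:R * G p.-1 - p%:R ^+ 2 * harm rat 3 p.-1 + p%:R ^+ 3 * v.
  rewrite !sE /v {1}sum_nat_rev !mulr_sumr -big_split -sumrB -big_split /=.
  apply: eq_big_nat => k kp; rewrite natrB; last by lia.
  have nz : k%:R != 0 :> rat by apply: natr_neq0; lia.
  have : (p - k)%:R != 0 :> rat by apply: natr_neq0; lia.
  rewrite natrB => [nzp|]; last by lia.
  by rewrite !expr1; field; rewrite nz nzp.
have -> : H p.-1 = (H p.-1 + H p.-1) / 2%:R by field.
by rewrite E Et; field.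
Qed.

(** Wolstenholme's theorem, from [harm1_pred_p] and the divisibility of [G p.-1] by [p]. *)
Lemma harm1_pred_p2 : exists2 h, h \in pint p & H p.-1 = p%:R ^+ 2 * h.
Proof.
have [r rp ->] := harm1_pred_p.
have [||t tp ->] := @ratr_eq0_pint F p charFp (G p.-1).
- by apply: pintH; lia.
- by rewrite (ratr_harm charFp) ?(harm_charp0 charFp) //; lia.
exists (- t / 2%:R + p%:R * r); last by field.
by pint.
Qed.

(** Reflection with [1 / (p - k)^2 = 1/k^2 + 2p/k^3 + p^2 (3k - 2p) / (k^3 (p - k)^2)]; the last
    term is the source of [v]. *)
Lemma polylog2_N1_mod : exists2 r, r \in pint p &
  polylog 2 (-1) = - p%:R * polylog 3 (-1) + p%:R ^+ 2 * r.
Proof.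
pose v : rat := \sum_(1 <= k < p) (-1) ^+ k * (3%:R * k%:R - 2%:R * p%:R)
   / (k%:R ^+ 3 * (p%:R - k%:R) ^+ 2).
have vp : v \in pint p.
  by rewrite /v; pint.
exists (- v / 2%:R); first by pint.
have E : polylog 2 (-1) + polylog 2 (-1)
    = - (2%:R * p%:R) * polylog 3 (-1) - p%:R ^+ 2 * v :> rat.
  rewrite /v {1}sum_nat_rev !mulr_sumr -big_split -sumrB /=.
  apply: eq_big_nat => k kp; rewrite natrB ?signr_subn_odd //; try lia.
  have nz : k%:R != 0 :> rat by apply: natr_neq0; lia.
  have : (p - k)%:R != 0 :> rat by apply: natr_neq0; lia.
  rewrite natrB => [nzp|]; last by lia.
  by field; rewrite nz nzp.
have -> : polylog 2 (-1) = (polylog 2 (-1) + polylog 2 (-1)) / 2%:R :> rat by field.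
by rewrite E; field.
Qed.

(* The binomial expansion of [(1 - 2) ^ p]. *)
Lemma polylog1_2_mod : exists2 r, r \in pint p &
  polylog 1 2%:R = - 2%:R * q
    + p%:R * \sum_(1 <= k < p) 2%:R ^+ k * H k.-1 / k%:R + p%:R ^+ 2 * r.
Proof.
exists (- \sum_(1 <= k < p) 2%:R ^+ k * c2 k.-1 / k%:R).
  by pint; apply: pint_c2; lia.
have := sum_binomial_pow (2%:R : rat) p.
rewrite big_nat_recr //= binn mul1r exprNn fermat_quotient2E.
rewrite (_ : 1 - 2%:R = -1 :> rat); last by ring.
rewrite -[(-1) ^+ p]signr_odd p_odd expr1.
have -> : \sum_(1 <= k < p) 'C(p, k)%:R * (- 2%:R) ^+ k
   = - p%:R * \sum_(1 <= k < p) 2%:R ^+ k * ((-1) ^+ k.-1 * 'C(p.-1, k.-1)%:R) / k%:R :> rat.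
  rewrite mulr_sumr; apply: eq_big_nat => -[//|k] kp /=.
  have nz : k.+1%:R != 0 :> rat by rewrite pnatr_eq0.
  have -> : 'C(p, k.+1)%:R = p%:R * 'C(p.-1, k)%:R / k.+1%:R :> rat.
    by rewrite -natrM mul_bin_diag natrM mulrAC divff ?mul1r.
  rewrite [(- 2%:R) ^+ _]exprNn exprS; move: (k.+1%:R : rat) nz => y nz.
  by field.
have -> : \sum_(1 <= k < p) 2%:R ^+ k * ((-1) ^+ k.-1 * 'C(p.-1, k.-1)%:R) / k%:R
   = polylog 1 2%:R - p%:R * \sum_(1 <= k < p) 2%:R ^+ k * H k.-1 / k%:R
     + p%:R ^+ 2 * \sum_(1 <= k < p) 2%:R ^+ k * c2 k.-1 / k%:R :> rat.
  rewrite !mulr_sumr -sumrB -big_split /=; apply: eq_bigr => k _.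
  by rewrite c2E expr1; ring.
move: (\sum_(1 <= k < p) _) (\sum_(1 <= k < p) _) (\sum_(1 <= k < p) _) => z y x E.
apply: (mulfI natr_p_neq0); apply/eqP; rewrite -subr_eq0; apply/eqP.
transitivity (-1 - 1 - (- p%:R * (x - p%:R * y + p%:R ^+ 2 * z)
   + -1 * (2%:R + 2%:R * p%:R * q))); first by ring.
by rewrite E; ring.
Qed.

(** Split the square by [i + j = m], [p] or [p + m], with [1 / (i j) = (1/i + 1/j) / (i + j)]. In
    the last case [1 / (p + m)] is expanded as [1/m - p/m^2 + p^2 g(m)], and [H p.-1] goes into the
    error. *)
Lemma polylog1_2_sq : exists2 r, r \in pint p &
  polylog 1 2%:R ^+ 2 = 2%:R * \sum_(1 <= k < p) 2%:R ^+ k * H k.-1 / k%:R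
    + 2%:R ^+ p * 2%:R * (H p.-1 / p%:R)
    - 2%:R ^+ p * 2%:R * (\sum_(1 <= k < p) 2%:R ^+ k * H k / k%:R
         - p%:R * \sum_(1 <= k < p) 2%:R ^+ k * H k / k%:R ^+ 2) + p%:R ^+ 2 * r.
Proof.
have [h hp Eh] := harm1_pred_p2.
pose g k : rat := (k%:R ^+ 2 * (p%:R + k%:R))^-1.
have gp k : (0 < k < p)%N -> g k \in pint p.
  move=> kp; rewrite /g invfM -exprVn rpredM ?rpredX ?pintV //.
  rewrite -natrD pint_natV // coprime_sym prime_coprime // dvdn_addr ?dvdnn //.
  by rewrite gtnNdvd; lia.
exists (2%:R ^+ p * 2%:R * \sum_(1 <= k < p) 2%:R ^+ k
     * (h * (k%:R^-1 - p%:R * (k%:R^-1) ^+ 2) + g k * (H p.-1 - H k))).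
  by pint; apply: gp.
pose f (i j : nat) : rat := 2%:R ^+ (i + j) / (i%:R * j%:R).
have -> : polylog 1 2%:R ^+ 2 = \sum_(1 <= i < p) \sum_(1 <= j < p) f i j.
  rewrite expr2 mulr_suml; apply: eq_bigr => i _; rewrite mulr_sumr.
  by apply: eq_bigr => j _; rewrite /f exprD !expr1 invfM mulrACA.
have HE m : H m = \sum_(1 <= j < m.+1) j%:R^-1.
  by apply: eq_bigr => j _; rewrite expr1.
rewrite sum_nat_pairs.
have -> : \sum_(1 <= j < p) f (p - j)%N j = 2%:R ^+ p * 2%:R * (H p.-1 / p%:R).
  transitivity (2%:R ^+ p / p%:R * \sum_(1 <= j < p) (j%:R^-1 + (p - j)%:R^-1) : rat).
    rewrite mulr_sumr; apply: eq_big_nat => j jp.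
    have nzj : j%:R != 0 :> rat by apply: natr_neq0; lia.
    have : (p - j)%:R != 0 :> rat by apply: natr_neq0; lia.
    rewrite /f subnK; last by lia.
    rewrite natrB => [nzp|]; last by lia.
    by field; rewrite nzj nzp natr_p_neq0.
  rewrite big_split /= -(sum_nat_rev p (fun j => j%:R^-1 : rat)) HE prednK //.
  by field.
have -> : \sum_(1 <= m < p) \sum_(1 <= j < m) f (m - j)%N j
    = 2%:R * \sum_(1 <= m < p) 2%:R ^+ m * H m.-1 / m%:R.
  rewrite mulr_sumr; apply: eq_big_nat => m mp.
  transitivity (2%:R ^+ m / m%:R * \sum_(1 <= j < m) (j%:R^-1 + (m - j)%:R^-1) : rat).
    rewrite mulr_sumr; apply: eq_big_nat => j jm.
    have nzm : m%:R != 0 :> rat by apply: natr_neq0; lia.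
    have nzj : j%:R != 0 :> rat by apply: natr_neq0; lia.
    have : (m - j)%:R != 0 :> rat by apply: natr_neq0; lia.
    rewrite /f subnK; last by lia.
    rewrite natrB => [nzp|]; last by lia.
    by field; rewrite nzj nzp nzm.
  rewrite big_split /= -(sum_nat_rev m (fun j => j%:R^-1 : rat)) HE prednK; last by lia.
  by ring.
have -> : \sum_(1 <= m < p) \sum_(m.+1 <= j < p) f (p + m - j)%N j
    = 2%:R ^+ p * 2%:R * \sum_(1 <= m < p) 2%:R ^+ m * (H p.-1 - H m) / (p%:R + m%:R).
  rewrite mulr_sumr; apply: eq_big_nat => m mp.
  have nzm : p%:R + m%:R != 0 :> rat by rewrite -natrD; apply: natr_neq0; lia.
  have hE : H p.-1 - H m = \sum_(m.+1 <= j < p) j%:R^-1.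
    rewrite !HE prednK // [X in X - _](big_cat_nat _ (n := m.+1)) //=; last by lia.
    by rewrite addrAC subrr add0r.
  transitivity (2%:R ^+ (p + m) / (p%:R + m%:R)
     * \sum_(m.+1 <= j < p) (j%:R^-1 + (p + m - j)%:R^-1) : rat).
    rewrite mulr_sumr; apply: eq_big_nat => j jm.
    have nzj : j%:R != 0 :> rat by apply: natr_neq0; lia.
    have : (p + m - j)%:R != 0 :> rat by apply: natr_neq0; lia.
    rewrite /f subnK; last by lia.
    rewrite natrB ?natrD => [nzp|]; last by lia.
    by field; rewrite nzj nzp nzm.
  rewrite big_split /= [X in _ * (_ + X)]big_nat_rev /=.
  rewrite (eq_big_nat _ _ (F2 := fun j => j%:R^-1 : rat)
    (F1 := fun j => (p + m - (m.+1 + p - j.+1))%:R^-1)); last first.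
    by move=> j jp; congr (_%:R^-1); lia.
  by rewrite -hE exprD; ring.
have -> : \sum_(1 <= m < p) 2%:R ^+ m * (H p.-1 - H m) / (p%:R + m%:R)
    = - (\sum_(1 <= k < p) 2%:R ^+ k * H k / k%:R
         - p%:R * \sum_(1 <= k < p) 2%:R ^+ k * H k / k%:R ^+ 2)
      + p%:R ^+ 2 * \sum_(1 <= k < p) 2%:R ^+ k
         * (h * (k%:R^-1 - p%:R * (k%:R^-1) ^+ 2) + g k * (H p.-1 - H k)) :> rat.
  rewrite !mulr_sumr -sumrB -sumrN -big_split /=; apply: eq_big_nat => k kp.
  have nzk : k%:R != 0 :> rat by apply: natr_neq0; lia.
  have nzpk : p%:R + k%:R != 0 :> rat by rewrite -natrD; apply: natr_neq0; lia.
  by rewrite /g Eh; field; rewrite nzk nzpk.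
by ring.
Qed.

End Supercongruence.

(* Solving the last hypothesis for [S] modulo [P ^ 2]: multiply it by [(1 - P x) / 4]. *)
Lemma solve_square_relation (R : numFieldType) (P x y S L D Ph u1 u3 u4 t4 r6 : R) :
  Ph = - P * y / 3%:R + P ^+ 2 * u1 ->
  D = - 13%:R / 12%:R * P * y + P ^+ 2 * u3 ->
  L = - 2%:R * x + P ^+ 2 * u4 ->
  L ^+ 2 = 2%:R * D + (2%:R + 2%:R * P * x) * 2%:R * Ph
      - (2%:R + 2%:R * P * x) * 2%:R
     * (S - P * (- (1 / 3%:R) * x ^+ 3 + 23%:R / 24%:R * y + P * t4)) + P ^+ 2 * r6 ->
  S - (- x ^+ 2 + 2%:R / 3%:R * P * x ^+ 3 + P / 12%:R * y) = P ^+ 2 *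
  (x ^+ 2 * S + (1 - P * x) / 4%:R *
  (4%:R * x * u4 - P ^+ 2 * u4 ^+ 2 + 2%:R * u3 + 4%:R * (1 + P * x) * (u1 + t4) + r6)
  - P * x ^+ 2 * (5%:R / 8%:R * y - x ^+ 3 / 3%:R) + 13%:R / 24%:R * x * y).
Proof.
move=> EP ED EL E; apply/eqP; rewrite -subr_eq0; apply/eqP.
transitivity ((1 - P * x) / 4%:R * (L ^+ 2 - (2%:R * D + (2%:R + 2%:R * P * x) * 2%:R * Ph
  - (2%:R + 2%:R * P * x) * 2%:R
     * (S - P * (- (1 / 3%:R) * x ^+ 3 + 23%:R / 24%:R * y + P * t4)) + P ^+ 2 * r6))).
  by rewrite EP ED EL {E EP ED EL}; field.
by rewrite E subrr mulr0.
Qed.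

(** * Transfer to the rationals and the six congruences *)

Section Assembly.
Variables (F : fieldType) (p : nat).
Hypotheses (charFp : p \in [pchar F]) (p_gt5 : (5 < p)%N).

Let p_prime : prime p := pcharf_prime charFp.

Local Notation H := (harm rat 1).
Local Notation G := (harm rat 2).
Local Notation HF := (harm F 1).
Local Notation GF := (harm F 2).
Local Notation polylog s x := (\sum_(1 <= k < p) x ^+ k / k%:R ^+ s).
Local Notation q := (fermat_quotient2 p).
Local Notation B := (bernoulli (p - 3)).
Local Notation qF := (ratr q : F).
Local Notation BF := (ratr B : F).
Local Notation red := (@reduces_to F p).

Let nzF k : (0 < k < p)%N -> k%:R != 0 :> F.
Proof. exact: natf_neq0_lt charFp k. Qed.

Let nz2 : 2%:R != 0 :> F. Proof. by apply: nzF; lia. Qed.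
Let nz3 : 3%:R != 0 :> F. Proof. by apply: nzF; lia. Qed.
Let nz4 : 4%:R != 0 :> F. Proof. by apply: nzF; lia. Qed.
Let nz8 : 8%:R != 0 :> F. Proof. by rewrite (natrX F 2 3) expf_neq0. Qed.
Let nz24 : 24%:R != 0 :> F. Proof. by rewrite (natrM F 8 3) mulf_neq0. Qed.

Let cop k : (0 < k < p)%N -> coprime k p.
Proof. exact: coprime_lt charFp k. Qed.
Let cop8 : coprime 8 p. Proof. by apply: (@coprimeXl 3 2); apply: cop; lia. Qed.
Let cop24 : coprime 24 p.
Proof. by rewrite (coprimeMl p 8 3) cop8 cop //; lia. Qed.

Let redq : red q qF.
Proof. by split; rewrite // pint_fermat_quotient2. Qed.
Let redB : red B BF.
Proof. by split; rewrite // (pint_bernoulli charFp) //; lia. Qed.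

Let redXV s k : (0 < k < p)%N -> red (k%:R ^+ s)^-1 (k%:R ^+ s)^-1.
Proof.
move=> kp; have := reduces_to_natV charFp (n := k ^ s) (coprimeXl s (cop kp)).
by rewrite !natrX.
Qed.

Let redXMV s n k : (0 < k < p)%N -> red (k%:R ^+ s * 2%:R ^+ n)^-1 (k%:R ^+ s * 2%:R ^+ n)^-1.
Proof.
move=> kp; have := reduces_to_natV charFp (n := k ^ s * 2 ^ n).
rewrite coprimeMl !coprimeXl ?cop //; last by lia.
by rewrite !natrM !natrX; apply.
Qed.

Let red0 x : x \in pint p -> red (p%:R * x) 0.
Proof.
move=> xp; rewrite -[0](mul0r (ratr x)) -(pcharf0 charFp).
by apply: reduces_toM charFp _ _ _ _ _ _; [apply: reduces_to_nat|].
Qed.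

Ltac pint_closed :=
  lazymatch goal with
  | |- is_true (in_mem (@Algebra.add _ _ _) _) => apply: rpredD; pint_closed
  | |- is_true (in_mem (@Algebra.opp _ _) _) => rewrite rpredN; pint_closed
  | |- is_true (in_mem (@GRing.mul _ _ _) _) => apply: rpredM; pint_closed
  | |- is_true (in_mem (@GRing.exp _ _ _) _) => apply: rpredX; pint_closed
  | |- is_true (in_mem (GRing.one _) _) => apply: rpred1
  | |- is_true (in_mem (@Algebra.natmul _ _ _) _) => apply: rpred_nat
  | _ => assumption
  end.

Ltac range :=
  first [ assumption
        | match goal with kp : is_true (_ && _) |- _ =>
            case/andP: kp => _ kp; exact: (leq_ltn_trans (leq_pred _) kp) end
        | match goal with kp : is_true (_ && _) |- _ => by case/andP: kp end
        | clear -p_gt5; lia ].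

Ltac reduce :=
  lazymatch goal with
  | |- reduces_to _ (@Algebra.add _ _ _) _ => refine (reduces_toD charFp _ _); reduce
  | |- reduces_to _ (@Algebra.opp _ _) _ => refine (reduces_toN _); reduce
  | |- reduces_to _ (@GRing.mul _ _ _) _ => refine (reduces_toM charFp _ _); reduce
  | |- reduces_to _ (@GRing.exp _ _ _) _ => refine (reduces_toX charFp _ _); reduce
  | |- reduces_to _ (GRing.one _) _ => exact (reduces_to_nat F p 1)
  | |- reduces_to _ (@Algebra.natmul _ _ _) _ => refine (reduces_to_nat _ _ _)
  | |- reduces_to _ (harm _ _ _) _ => refine (reduces_to_harm charFp _ _); range
  | |- reduces_to _ (@GRing.inv _ (@GRing.mul _ _ _)) _ => refine (redXMV _ _ _); range
  | |- reduces_to _ (@GRing.inv _ (@GRing.exp _ _ _)) _ => refine (redXV _ _); range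
  | |- reduces_to _ (@GRing.inv _ (@Algebra.natmul _ _ 8)) _ =>
      exact (reduces_to_natV charFp cop8)
  | |- reduces_to _ (@GRing.inv _ (@Algebra.natmul _ _ 24)) _ =>
      exact (reduces_to_natV charFp cop24)
  | |- reduces_to _ (@GRing.inv _ (@Algebra.natmul _ _ _)) _ =>
      refine (reduces_to_natV charFp (cop _)); range
  | |- reduces_to _ (@bigop.body _ _ _ _ _) _ =>
      let k := fresh "k" in let kp := fresh "kp" in
      refine (reduces_to_sum_nat charFp _) => k kp; reduce
  | _ => assumption
  end.

Let b0 : ratr (bernoulli 0) = 1 :> F.
Proof. by rewrite bernoulli0 (ratr_nat _ 1). Qed.

Let sumH_div2 : \sum_(1 <= k < p) HF k / k%:R ^+ 2 = BF :=
  sum_harm1_div2 charFp p_gt5 (b := fun k => ratr (bernoulli k)) b0 (ratr_bernoulli_rec charFp).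
Let alt_div3 : polylog 3 (-1) = - BF / 2%:R :=
  sum_alt_div3 charFp p_gt5 (b := fun k => ratr (bernoulli k)) b0 (ratr_bernoulli_rec charFp).

Let sum2H_pred : \sum_(1 <= k < p) 2%:R ^+ k * HF k.-1 / k%:R = 0.
Proof.
have := polylog2_dual charFp p_gt5 (-1).
rewrite (_ : 1 - -1 = 2%:R); last by ring.
by rewrite polylog2_N1 // => /esym/eqP; rewrite oppr_eq0 => /eqP.
Qed.

Let sum_altH : \sum_(1 <= k < p) (-1) ^+ k * HF k / k%:R ^+ 2 = - BF / 4%:R.
Proof.
transitivity (\sum_(1 <= k < p) (-1) ^+ k * HF k.-1 / k%:R ^+ 2 + polylog 3 (-1)).
  rewrite -big_split /=; apply: eq_big_nat => k kp; have nz := nzF kp.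
  by rewrite harm_pred ?expr1; [field|case/andP: kp].
by rewrite (sum_alt_harm1 charFp p_gt5 alt_div3) alt_div3; field; rewrite nz2 nz4.
Qed.

Let polylog1_2F : polylog 1 2%:R = - 2%:R * qF.
Proof.
have [r rp E] := polylog1_2_mod p_prime p_gt5.
apply: (@reduces_to_eq F p (polylog 1 2%:R)); first by reduce.
rewrite E -addrA expr2 -mulrA -mulrDr -[X in reduces_to _ _ X]addr0.
apply: (reduces_toD charFp); first by reduce.
apply: red0; rewrite rpredD ?rpredM ?rpred_nat //.
by have [] : red (\sum_(1 <= k < p) 2%:R ^+ k * H k.-1 / k%:R)
   (\sum_(1 <= k < p) 2%:R ^+ k * HF k.-1 / k%:R) by reduce.
Qed.

(** Modulo [p], [polylog1_2_sq] loses the sum with [H k.-1] by [sum2H_pred] and the term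
    [H p.-1 / p] by Wolstenholme, leaving [4 q ^ 2 = - 4 L_2(2)]. *)
Let polylog2_2F : polylog 2 2%:R = - qF ^+ 2.
Proof.
have [r rp] := polylog1_2_sq p_prime p_gt5.
have [h hp ->] := harm1_pred_p2 p_prime p_gt5.
have nzp : p%:R != 0 :> rat by rewrite pnatr_eq0; lia.
set S2 := \sum_(1 <= k < p) 2%:R ^+ k * H k / k%:R ^+ 2.
have S2p : S2 \in pint p.
  suff [] : red S2 (\sum_(1 <= k < p) 2%:R ^+ k * HF k / k%:R ^+ 2) by [].
  by rewrite /S2; reduce.
have -> : p%:R ^+ 2 * h / p%:R = p%:R * h by field.
rewrite [p%:R ^+ 2]expr2 -[_ * r]mulrA => E.
have : red (polylog 1 2%:R ^+ 2) (polylog 1 2%:R ^+ 2) by reduce.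
have redph := red0 hp.
have redpr := red0 (rpredM (rpred_nat _ p) rp).
have redpS := red0 S2p.
have : red (polylog 1 2%:R ^+ 2)
   (2%:R * (\sum_(1 <= k < p) 2%:R ^+ k * HF k.-1 / k%:R) + 2%:R ^+ p * 2%:R * 0
    - 2%:R ^+ p * 2%:R * ((\sum_(1 <= k < p) 2%:R ^+ k * HF k / k%:R) - 0) + 0).
  rewrite E.
  refine (reduces_toD charFp (reduces_toD charFp (reduces_toD charFp _ _) _) redpr).
  - by reduce.
  - by refine (reduces_toM charFp _ redph); reduce.
  refine (reduces_toN (reduces_toM charFp _ (reduces_toD charFp _ (reduces_toN redpS)))).
    by reduce.
  by reduce.
move=> /reduces_to_eq R1 /R1.
rewrite sum2H_pred sum_2harm_div // (natf_expp charFp 2) polylog1_2F => E2.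
have nz : 4%:R != 0 :> F := nz4.
apply: (mulfI nz).
transitivity (- (2%:R * 0 + 2%:R * 2%:R * 0 - 2%:R * 2%:R * (polylog 2 2%:R - 0) + 0) : F).
  by ring.
by rewrite E2; ring.
Qed.

(** With the known sums inserted, [polylog12_mul] is the linear equation
    [2 q ^ 3 = - 6 L_3(2) - 7 B / 4]. *)
Let polylog3_2F : polylog 3 2%:R = - (1 / 3%:R) * qF ^+ 3 - 7%:R / 24%:R * BF.
Proof.
have := polylog12_mul charFp p_gt5.
rewrite (sum_2harm2_div charFp p_gt5 sumH_div2 alt_div3).
rewrite (sum_2harm_div2 charFp p_gt5 sumH_div2 alt_div3) polylog1_2F polylog2_2F.
move: (polylog 3 2%:R) => x E.
have nz6 : 6%:R != 0 :> F by rewrite (natrM F 2 3) mulf_neq0.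
apply: (mulfI nz6).
transitivity (- (- (x - 3%:R / 4%:R * BF) - 2%:R * (x + 5%:R / 4%:R * BF) - 3%:R * x)
   - 7%:R / 4%:R * BF); first by field.
by rewrite -E; field; rewrite nz3 nz4 nz24.
Qed.

Lemma sum_2harm_div2_mod : rat_eqmod p 1
  (\sum_(1 <= k < p) 2%:R ^+ k * H k / k%:R ^+ 2)
  (- (1 / 3%:R) * q ^+ 3 + 23%:R / 24%:R * B).
Proof.
apply: (rat_eqmod_reduces_to charFp (z := - (1 / 3%:R) * qF ^+ 3 + 23%:R / 24%:R * BF)).
  rewrite (_ : _ + _ = \sum_(1 <= k < p) 2%:R ^+ k * HF k / k%:R ^+ 2); first by reduce.
  rewrite (sum_2harm_div2 charFp p_gt5 sumH_div2 alt_div3) polylog3_2F.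
  by field; rewrite nz3 nz4 nz24.
by reduce.
Qed.

Lemma sum_harm_div_2pow_mod : rat_eqmod p 1
  (\sum_(1 <= k < p) H k / (k%:R ^+ 2 * 2%:R ^+ k)) (5%:R / 8%:R * B).
Proof.
apply: (rat_eqmod_reduces_to charFp (z := 5%:R / 8%:R * BF)); last by reduce.
by rewrite -(sum_harm_div_2pow charFp p_gt5 sumH_div2 alt_div3); reduce.
Qed.

Lemma sum_2harmsq_div_mod : rat_eqmod p 1
  (\sum_(1 <= k < p) 2%:R ^+ k * H k ^+ 2 / k%:R)
  (- (1 / 3%:R) * q ^+ 3 + 11%:R / 24%:R * B).
Proof.
apply: (rat_eqmod_reduces_to charFp (z := - (1 / 3%:R) * qF ^+ 3 + 11%:R / 24%:R * BF)).
  rewrite (_ : _ + _ = \sum_(1 <= k < p) 2%:R ^+ k * HF k ^+ 2 / k%:R); first by reduce.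
  rewrite (sum_2harmsq_div charFp p_gt5 sumH_div2 alt_div3) polylog3_2F.
  by field; rewrite nz3 nz4 nz24.
by reduce.
Qed.

Lemma sum_harmsq_div_2pow_mod : rat_eqmod p 1
  (\sum_(1 <= k < p) H k ^+ 2 / (k%:R * 2%:R ^+ k)) (7%:R / 8%:R * B).
Proof.
apply: (rat_eqmod_reduces_to charFp (z := 7%:R / 8%:R * BF)); last by reduce.
rewrite -(sum_harmsq_div_2pow charFp p_gt5 sumH_div2 alt_div3).
apply: (reduces_to_sum_nat charFp) => k kp; apply: (reduces_toM charFp); first by reduce.
by have := redXMV 1 k kp; rewrite !expr1.
Qed.

Lemma sum_2harm2_div_mod : rat_eqmod p 1
  (\sum_(1 <= k < p) 2%:R ^+ k * G k / k%:R)
  (- (1 / 3%:R) * q ^+ 3 - 25%:R / 24%:R * B).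
Proof.
apply: (rat_eqmod_reduces_to charFp (z := - (1 / 3%:R) * qF ^+ 3 - 25%:R / 24%:R * BF)).
  rewrite (_ : _ - _ = \sum_(1 <= k < p) 2%:R ^+ k * GF k / k%:R); first by reduce.
  rewrite (sum_2harm2_div charFp p_gt5 sumH_div2 alt_div3) polylog3_2F.
  by field; rewrite nz3 nz4 nz24.
by reduce.
Qed.

Lemma sum_2harm_div_mod : rat_eqmod p 2
  (\sum_(1 <= k < p) 2%:R ^+ k * H k / k%:R)
  (- q ^+ 2 + 2%:R / 3%:R * p%:R * q ^+ 3 + p%:R / 12%:R * B).
Proof.
have nzp : p%:R != 0 :> rat by rewrite pnatr_eq0; lia.
have qp : q \in pint p by case: redq.
have Bp : B \in pint p by case: redB.
have natVp k : (0 < k < p)%N -> k%:R^-1 \in pint p by move=> kp; apply: pint_natV; apply: cop.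
have inv2 : 2%:R^-1 \in pint p by apply: natVp; clear -p_gt5; lia.
have inv3 : 3%:R^-1 \in pint p by apply: natVp; clear -p_gt5; lia.
have inv4 : 4%:R^-1 \in pint p by apply: natVp; clear -p_gt5; lia.
have inv8 : 8%:R^-1 \in pint p by apply: pint_natV.
have inv24 : 24%:R^-1 \in pint p by apply: pint_natV.
have pp : p%:R \in pint p := rpred_nat _ p.
(* The weight 3 sums occur below only with a factor [p], so their values modulo [p], with explicit
   quotients [t1] to [t4], suffice. *)
have [t1 t1p T1] : exists2 r, r \in pint p &
    \sum_(1 <= k < p) H k / k%:R ^+ 2 = B + p%:R * r.
  by apply: (reduces_to_lift charFp (z := BF)) => //; rewrite -sumH_div2; reduce.
have [t2 t2p T2] : exists2 r, r \in pint p &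
    \sum_(1 <= k < p) (-1) ^+ k * H k / k%:R ^+ 2 = - B / 4%:R + p%:R * r.
  apply: (reduces_to_lift charFp (z := - BF / 4%:R)); last by reduce.
  by rewrite -sum_altH; reduce.
have [t3 t3p T3] : exists2 r, r \in pint p &
    polylog 3 (-1) = - B / 2%:R + p%:R * r.
  by apply: (reduces_to_lift charFp (z := - BF / 2%:R)); [rewrite -alt_div3|]; reduce.
have [t4 t4p T4] : exists2 r, r \in pint p &
    \sum_(1 <= k < p) 2%:R ^+ k * H k / k%:R ^+ 2
      = - (1 / 3%:R) * q ^+ 3 + 23%:R / 24%:R * B + p%:R * r.
  by have [r rp /eqP] := sum_2harm_div2_mod; rewrite subr_eq addrC expr1 => /eqP; exists r.
have L1p : polylog 1 2%:R \in pint p.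
  by have [] : red (polylog 1 2%:R) (polylog 1 2%:R) by reduce.
have Sp : \sum_(1 <= k < p) 2%:R ^+ k * H k / k%:R \in pint p.
  by have [] : red (\sum_(1 <= k < p) 2%:R ^+ k * H k / k%:R)
     (\sum_(1 <= k < p) 2%:R ^+ k * HF k / k%:R) by reduce.
have [h hp Eh] := harm1_pred_p2 p_prime p_gt5.
have [r1 r1p E1] := bin_transform_at1 p_prime p_gt5.
have [r2 r2p E2] := bin_transform_atN1 p_prime p_gt5.
have [r3 r3p E3] := harm1_pred_p p_prime p_gt5.
have [r4 r4p E4] := polylog2_N1_mod p_prime p_gt5.
have [r5 r5p E5] := polylog1_2_mod p_prime p_gt5.
have [r6 r6p E6] := polylog1_2_sq p_prime p_gt5.
move: E1 E2 E3 E4 E5 E6 Sp L1p; rewrite T1 T2 T3 T4 (fermat_quotient2E p_prime p_gt5) {T1 T2 T3 T4}.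
move: (\sum_(1 <= k < p) 2%:R ^+ k * H k / k%:R) => S.
move: (\sum_(1 <= k < p) 2%:R ^+ k * H k.-1 / k%:R) => D.
rewrite Eh; move: (polylog 2 (-1)) (polylog 1 2%:R) (G p.-1) => N L g {Eh}.
rewrite /rat_eqmod; move: q B qp Bp => x y xp yp.
move: (p%:R : rat) nzp pp => P nzP Pp E1 E2 E3 E4 E5 E6 Sp Lp.
(* [E1] reads [3 g / 2 = P y] modulo [P ^ 2]; the [u] with an index collect the remainders. *)
pose u2 := 2%:R / 3%:R * (t1 - r1 - P ^+ 2 * h ^+ 2 / 2%:R).
have Eg : g = 2%:R / 3%:R * P * y + P ^+ 2 * u2.
  transitivity (2%:R / 3%:R * ((g - P * (y + P * t1) + P ^+ 2 * r1)
    + P * (y + P * t1) - P ^+ 2 * r1 + g / 2%:R)); first by field.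
  by rewrite E1 /u2; field.
pose u1 := r3 - u2 / 2%:R.
have Eh : P ^+ 2 * h / P = - P * y / 3%:R + P ^+ 2 * u1.
  by rewrite E3 Eg /u1; field.
(* In [E2], the contributions [-1/3] from [g], [-1/2] from [N] and [-1/4] from the alternating sum
   add up to [-13/12]. *)
pose u3 := h * L - P ^+ 2 * h ^+ 2 / 2%:R - u2 / 2%:R + t3 - r4 + t2 - r2.
have ED : D = - 13%:R / 12%:R * P * y + P ^+ 2 * u3.
  transitivity (P ^+ 2 * h * L - ((P ^+ 2 * h) ^+ 2 + g) / 2%:R
    - (P ^+ 2 * h * L - D - ((P ^+ 2 * h) ^+ 2 + g) / 2%:R)); first by ring.
  by rewrite -E2 E4 Eg /u3; field.
(* The coefficient [13/12] is written [26/24] so that [inv24] settles its integrality. *)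
pose u4 := - 26%:R / 24%:R * y + P * u3 + r5.
have EL : L = - 2%:R * x + P ^+ 2 * u4 by rewrite E5 ED /u4; field.
have E := solve_square_relation Eh ED EL E6.
eexists; last exact: E.
have u2p : u2 \in pint p by rewrite /u2; pint_closed.
have u1p : u1 \in pint p by rewrite /u1; pint_closed.
have u3p : u3 \in pint p by rewrite /u3; pint_closed.
have u4p : u4 \in pint p by rewrite /u4; pint_closed.
match goal with |- is_true (coprimez (denq ?r) _) => suff : r \in pint p by [] end.
by pint_closed.
Qed.

End Assembly.

Theorem theorem1p1 (p : nat) (p_prime : prime p) (p_gt5 : (5 < p)%N) :
  let q := fermat_quotient2 p in
  let B := bernoulli (p - 3) in
  [/\ [/\ rat_eqmod p 2
            (\sum_(1 <= k < p) 2 ^+ k * harmonic k / k%:R)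
            (- q ^+ 2 + 2 / 3 * p%:R * q ^+ 3 + p%:R / 12 * B),
          rat_eqmod p 1
            (\sum_(1 <= k < p) 2 ^+ k * harmonic k / k%:R ^+ 2)
            (- (1 / 3) * q ^+ 3 + 23 / 24 * B) &
          rat_eqmod p 1
            (\sum_(1 <= k < p) harmonic k / (k%:R ^+ 2 * 2 ^+ k))
            (5 / 8 * B)],
      rat_eqmod p 1
        (\sum_(1 <= k < p) 2 ^+ k * harmonic k ^+ 2 / k%:R)
        (- (1 / 3) * q ^+ 3 + 11 / 24 * B),
      rat_eqmod p 1
        (\sum_(1 <= k < p) harmonic k ^+ 2 / (k%:R * 2 ^+ k))
        (7 / 8 * B) &
      rat_eqmod p 1
        (\sum_(1 <= k < p) 2 ^+ k * harmonic_gen k 2 / k%:R)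
        (- (1 / 3) * q ^+ 3 - 25 / 24 * B)].
Proof.
(* All reductions take place in ['F_p]; [harmonic] and [harmonic_gen] match [harm rat] by
   conversion. *)
have charFp := pchar_Fp p_prime.
split; first split.
- exact: (sum_2harm_div_mod charFp).
- exact: (sum_2harm_div2_mod charFp).
- exact: (sum_harm_div_2pow_mod charFp).
- exact: (sum_2harmsq_div_mod charFp).
- exact: (sum_harmsq_div_2pow_mod charFp).
exact: (sum_2harm2_div_mod charFp).
Qed.
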